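(* Let $0<\beta\leqslant 1$ and $\delta\in\mathbb{R}$. Let $\mathcal{H}$ be a separable Hilbert space and let $\mathfrak{L}:\mathrm{Dom}(\mathfrak{L})\subset\mathcal{H}\to\mathcal{H}$ be a densely defined positive linear operator with discrete spectrum $\sigma(\mathfrak{L})=\{\gamma_\zeta:\zeta\in I\}$ ($I$ countable), whose system of eigenfunctions $\{e_\zeta\}_{\zeta\in I}$ is an orthonormal basis of $\mathcal{H}$. Consider the $\mathfrak{L}$-heat type equation $$\,^{C}\partial_t^{\beta}w(t)+\mathfrak{L}w(t)=0,\quad t>0,\qquad w(t)|_{t=0}=w_0\in\mathcal{H}. \qquad (\ast)$$ (1) If $0\in\sigma(\mathfrak{L})$ and $w_0\in\mathcal{H}_{\mathfrak{L}}^{\delta}$, then there exists a unique continuous solution $w$ of $(\ast)$ with $w(t)\in\mathcal{H}_{\mathfrak{L}}^{\delta}$ for any $t\in(0,+\infty)$; it is given by $$w(t)=\sum_{\zeta\in I}(w_0,e_\zeta)_{\mathcal{H}}\,E_{\beta}(-\gamma_\zeta t^{\beta})\,e_\zeta,\qquad (\ast\ast)$$ and it satisfies $$\|w(t)\|_{\mathcal{H}_{\mathfrak{L}}^{\delta}}\lesssim\|w_0\|_{\mathcal{H}_{\mathfrak{L}}^{\delta}},\quad t\geqslant 0.$$ (2) If $0\notin\sigma(\mathfrak{L})$ and $w_0\in\mathcal{H}_{\mathfrak{L}}^{\delta}$, then there exists a unique continuous solution $w$ of $(\ast)$ with $w(t)\in\mathcal{H}_{\mathfrak{L}}^{\delta}$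 for any $t\in(0,+\infty)$, represented by $(\ast\ast)$, such that $$\|w(t)\|_{\mathcal{H}_{\mathfrak{L}}^{\delta}}\lesssim(1+t^{\beta})^{-1}\|w_0\|_{\mathcal{H}_{\mathfrak{L}}^{\delta}},\quad t\geqslant 0.$$ (3) If $w_0\in\mathcal{H}_{\mathfrak{L}}^{\delta-2}$, then there exists a unique continuous solution $w$ of $(\ast)$ with $w(t)\in\mathcal{H}_{\mathfrak{L}}^{\delta}$ for any $t\in(0,+\infty)$, given by $(\ast\ast)$, and $$\|w(t)\|_{\mathcal{H}_{\mathfrak{L}}^{\delta}}\lesssim(1+t^{-\beta})\|w_0\|_{\mathcal{H}_{\mathfrak{L}}^{\delta-2}},\quad t>0.$$
   Context: Positivity of $\mathfrak{L}$ means $\gamma_\zeta\geqslant 0$ for all $\zeta$ (the value $0$ is allowed); $\mathfrak{L}e_\zeta=\gamma_\zeta e_\zeta$. The notation $A\lesssim B$ means $A\leqslant CB$ with a constant $C>0$ independent of $t$ and of the initial data. Dzhrbashyan–Caputo derivative: for $0<\beta<1$, $\,^{C}\partial_t^{\beta}f(t)=\frac{1}{\Gamma(1-\beta)}\int_0^t(t-s)^{-\beta}f'(s)\,ds$; for $\beta=1$ it is the ordinary derivative $\partial_t$. Mittag-Leffler function: $E_{\beta}(z)=\sum_{k=0}^{\infty}\frac{z^k}{\Gamma(\beta k+1)}$, $z\in\mathbb{C}$. $\mathfrak{L}$-Fourier coefficients: $\widehat f(\zeta)=(f,e_\zeta)_{\mathcal{H}}$. For $\delta\in\mathbb{R}$,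 the Sobolev space $\mathcal{H}_{\mathfrak{L}}^{\delta}$ consists of those $f$ (identified with its expansion $\sum_\zeta\widehat f(\zeta)e_\zeta$) for which $(I+\mathfrak{L})^{\delta/2}f\in\mathcal{H}$, with norm $\|f\|_{\mathcal{H}_{\mathfrak{L}}^{\delta}}=\|(I+\mathfrak{L})^{\delta/2}f\|_{\mathcal{H}}=\big(\sum_{\zeta\in I}(1+\gamma_\zeta)^{\delta}|\widehat f(\zeta)|^2\big)^{1/2}$; for $\delta<0$ this is the completion of $\mathcal{H}$ in this norm. Solutions are understood through the $\mathfrak{L}$-Fourier transform: $w(t)=\sum_\zeta w_\zeta(t)e_\zeta$ is a solution if for each $\zeta\in I$ the coefficient $w_\zeta(t)=(w(t),e_\zeta)_{\mathcal{H}}$ solves the scalar problem $\,^{C}\partial_t^{\beta}w_\zeta(t)+\gamma_\zeta w_\zeta(t)=0$, $t>0$, $w_\zeta(0)=(w_0,e_\zeta)_{\mathcal{H}}$. Continuous means continuous in $t$ with values in $\mathcal{H}$. *)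

(* Defs.v *)
From mathcomp Require Import all_boot all_order all_algebra.
From mathcomp Require Import sesquilinear complex.
From mathcomp Require Import all_classical all_reals all_analysis.
From mathcomp.analysis.showcase Require Import summability.
Set Implicit Arguments.
Unset Strict Implicit.
Unset Printing Implicit Defensive.
Import Order.TTheory GRing.Theory Num.Theory.
Import numFieldNormedType.Exports.
Local Open Scope classical_set_scope.
Local Open Scope ring_scope.
Local Open Scope complex_scope.

(* Possibly unbounded linear operator; the values of [op_fun] off [op_dom] are
   irrelevant. *)
Record operator (K : numDomainType) (H : lmodType K) := Operator {
  op_dom : set H ;
  op_fun :> H -> H ;
  op_dom0 : op_dom 0 ;
  op_domP : forall (a : K) (x y : H),
    op_dom x -> op_dom y -> op_dom (a *: x + y) ;
  op_linear : forall (a : K) (x y : H),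
    op_dom x -> op_dom y -> op_fun (a *: x + y) = a *: op_fun x + op_fun y }.

Definition resolvent_set (K : numFieldType) (H : normedModType K)
    (L : operator H) : set K :=
  [set z | exists B : {linear H -> H},
    [/\ continuous B,
        (forall y, op_dom L (B y) /\ L (B y) - z *: B y = y) &
        (forall x, op_dom L x -> B (L x - z *: x) = x)] ].

Definition spectrum (K : numFieldType) (H : normedModType K)
    (L : operator H) : set K := ~` resolvent_set L.

Definition discrete_subset (K : numFieldType) (A : set K) :=
  A `<=` isolated A.

Definition separable (T : topologicalType) :=
  exists2 A : set T, countable A & dense A.

Definition orthonormal_basis (K : numClosedFieldType) (H : normedModType K)
    (ip : {dot H for Num.conj}) (I : eqType) (e : I -> H) :=
  (forall i j, ip (e i) (e j) = (i == j)%:R) /\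
  dense [set x | exists (s : seq I) (c : I -> K), x = \sum_(i <- s) c i *: e i].

(* Meaningful for [0 < x] only. *)
Definition Gamma (R : realType) (x : R) : R :=
  \int[lebesgue_measure]_(t in `]0%R, +oo[) (t `^ (x - 1) * expR (- t)).

Definition mittag_leffler (R : realType) (beta : R) (z : R[i]) : R[i] :=
  (* [R[i]] carries its topology through the alias [R[i]^o]. *)
  lim ([series (z ^+ k / (Gamma (beta * k%:R + 1))%:C : R[i]^o)]_k @ \oo).

Section caputo.
Variable R : realType.
Implicit Types (beta t : R).

Definition caputo_integrand beta (f : R -> R) t (s : R) : R :=
  (t - s) `^ (- beta) * derive1 f s.

(* What the defining formula needs in order to make sense at [t]; no further
   regularity of [f] is imposed. *)
Definition caputo_ex beta (f : R -> R) t : Prop :=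
  if beta == 1 then derivable f t 1
  else (forall s, 0 < s < t -> derivable f s 1) /\
    lebesgue_measure.-integrable `]0, t[ (EFin \o caputo_integrand beta f t).

Definition caputo beta (f : R -> R) t : R :=
  if beta == 1 then derive1 f t
  else (Gamma (1 - beta))^-1 *
    \int[lebesgue_measure]_(s in `]0, t[) caputo_integrand beta f t s.

(* Complex-valued functions are differentiated and integrated componentwise. *)
Definition caputoC_ex beta (f : R -> R[i]) t : Prop :=
  caputo_ex beta (fun s => complex.Re (f s)) t /\
  caputo_ex beta (fun s => complex.Im (f s)) t.

Definition caputoC beta (f : R -> R[i]) t : R[i] :=
  caputo beta (fun s => complex.Re (f s)) t +i*
  caputo beta (fun s => complex.Im (f s)) t.

Definition scalar_solution beta (gamma : R) (c0 : R[i]) (f : R -> R[i]) :=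
  (forall t, 0 < t ->
     caputoC_ex beta f t /\ caputoC beta f t + gamma%:C * f t = 0) /\
  f 0 = c0.

End caputo.

Section heat.
Variables (R : realType) (H : completeNormedModType R[i]).
Variables (ip : {dot H for Num.conj}) (I : countType).
Variables (gamma : I -> R) (e : I -> H).

Definition fourier (f : H) : I -> R[i] := fun i => ip f (e i).

(* [(I + L)^(delta / 2)] on coefficient families. *)
Definition potential (delta : R) (c : I -> R[i]) : I -> R[i] :=
  fun i => ((1 + gamma i) `^ (delta / 2))%:C * c i.

(* An element of the Sobolev space is identified with the family of its
   coefficients; [f : H] is the family [fourier f].  For [delta < 0] the space
   of such families is the completion of [H] in the norm [sobolev_norm]. *)
Definition sobolev (delta : R) : set (I -> R[i]) :=
  [set c | exists g : H, fourier g = potential delta c].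

Definition sobolev_norm (delta : R) (c : I -> R[i]) : \bar R :=
  poweR (\esum_(i in [set: I])
    ((1 + gamma i) `^ delta * Normc.normc (c i) ^+ 2)%:E) 2^-1.

Definition heat_solution (beta : R) (w0 : H) (w : R -> H) :=
  forall i, scalar_solution beta (gamma i) (fourier w0 i)
              (fun t => fourier (w t) i).

Definition sobolev_solution (beta delta : R) (w0 : H) (w : R -> H) :=
  [/\ {within `[0, +oo[, continuous w},
      heat_solution beta w0 w &
      forall t, 0 < t -> sobolev delta (fourier (w t))].

(* Functions of time are only relevant on [0, +oo[. *)
Definition unique_sobolev_solution (beta delta : R) (w0 : H) (w : R -> H) :=
  sobolev_solution beta delta w0 w /\
  forall v, sobolev_solution beta delta w0 v -> forall t, 0 <= t -> v t = w t.

(* The sum over [I] is the limit of the net of its finite partial sums. *)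
Definition given_by_series (beta : R) (w0 : H) (w : R -> H) :=
  forall t, 0 <= t ->
    partial_sum (fun i =>
      (ip w0 (e i) * mittag_leffler beta (- (gamma i * t `^ beta)%:C)) *: e i)
    @ totally --> w t.

End heat.

(* Main.v *)
Require Import Defs.
From mathcomp Require Import all_boot all_order all_algebra.
From mathcomp Require Import sesquilinear complex finmap.
From mathcomp Require Import all_classical all_reals all_analysis.
From mathcomp Require Import measurable_realfun.
From mathcomp.analysis.showcase Require Import summability.
From mathcomp Require Import ring lra.

(** Expand everything in the orthonormal basis of eigenvectors.  The equation
    splits into scalar problems, one for each eigenvalue [g >= 0], and the
    statement reduces to facts about the function [relax beta g] which maps [t]
    to [E_beta(- g t^beta)].

    It solves the scalar problem with initial value [1]: the fractional integral of
    [s^(b - 1) E_(beta,b)(l s^beta)], where [E_(beta,b)] is the two-parameter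
    Mittag-Leffler function, is computed term by term by Euler's beta integral
    ([ML_convolution]), and the case [b = beta] is the Caputo derivative
    ([relax_caputo]).

    Uniqueness and all bounds come from a comparison principle ([caputo_le0]): a
    continuous function with nonpositive initial value, whose Caputo derivative is
    nonpositive wherever the function is positive, is nonpositive.  For [beta < 1] it
    rests on the extremum principle ([caputo_gt0_at_max]), according to which the
    Caputo derivative is positive at a maximum that exceeds the initial value.
    A solution is only assumed to be differentiable, with a derivative integrable
    against the kernel, so the integration by parts behind the extremum principle
    is replaced by the inequality [F b - F a <= int h] for an everywhere
    differentiable [F] with [F' <= h] and [h] Lebesgue integrable
    ([sub_le_integral_of_derive_le]).

    The comparison principle gives uniqueness, [0 <= relax beta g <= 1], and
    monotonicity in [g], hence in [t].  With monotonicity the Volterra form of the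
    equation yields the decay [(1 + g t^beta) relax beta g t <= 1 + Gamma(beta + 1)]
    ([relax_decay]).

    In the Hilbert space, a bounded family of multipliers acts on coefficients by
    Bessel's inequality and completeness ([multiplier_cvg], [multiplier_norm]), and
    the solution is the action of the multipliers [relax beta (gamma i) t] on [w0].
    The first norm estimate is [relax <= 1].  If [0] is not in the spectrum, the
    eigenvalues are bounded below by a positive constant ([spectral_gap]), and the
    decay gives the factor [(1 + t^beta)^-1].  For the third estimate,
    [1 + g <= (1 + t^(- beta)) (1 + g t^beta)] trades two orders of smoothness for the
    factor [1 + t^(- beta)]. *)

Set Implicit Arguments.
Unset Strict Implicit.
Unset Printing Implicit Defensive.
Import Order.TTheory GRing.Theory Num.Theory.
Import numFieldNormedType.Exports.
Local Open Scope classical_set_scope.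
Local Open Scope ring_scope.
Local Open Scope complex_scope.
#[local] Existing Instance totally_filter.

(** * Affine changes of variables *)

Section affine.
Context {R : realType}.
Local Notation mu := (@lebesgue_measure R).
Local Open Scope ereal_scope.

Let aff (c d : R) : measurableTypeR R -> measurableTypeR R := fun x => (c * x + d)%R.

Let measurable_aff c d : measurable_fun setT (aff c d).
Proof. by apply: measurable_funD => //; exact: measurable_funM. Qed.

(** The Lebesgue measure is determined by its values on half-open intervals,
    and the preimage of such an interval is an interval whose length is divided
    by the slope. *)
Lemma lebesgue_measure_affine (c d : R) (c0 : (0 < c)%R) (A : set R) :
  measurable A -> mu A = c%:E * pushforward mu (aff c d) A.
Proof.
move=> mA.
pose nu := mscale (NngNum (ltW c0))
    (measure_function_pushforward__canonical__measure_function_Measure mu (measurable_aff c d)).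
suff -> : mu A = nu A by [].
apply: lebesgue_measure_unique => //= _ [[a b]] _ <-.
rewrite /nu /mscale /=.
rewrite /pushforward /=.
have -> : aff c d @^-1` [set` `]a, b]%R] = [set` `]((a - d) / c)%R, ((b - d) / c)%R]%R].
  apply/seteqP; split => x /=; rewrite !in_itv/= ltr_pdivrMr// ler_pdivlMr// /aff =>
      /andP[h1 h2]; apply/andP; split; lra.
rewrite !lebesgue_measure_itv/= !lte_fin ltr_pM2r ?invr_gt0// ltrD2r.
case: ifP => ab; last by rewrite mule0.
by rewrite -!EFinB -EFinM; congr EFin; field; rewrite gt_eqF.
Qed.

Lemma ge0_integral_affine (c d : R) (f : R -> \bar R) : (0 < c)%R ->
  measurable_fun [set: R] f -> (forall r, 0 <= f r) ->
  \int[mu]_r f r = c%:E * \int[mu]_r f (c * r + d)%R.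
Proof.
move=> c0 mf f0.
pose nu := mscale (NngNum (ltW c0))
    (measure_function_pushforward__canonical__measure_function_Measure mu (measurable_aff c d)).
transitivity (\int[nu]_r f r).
  by apply: eq_measure_integral => A mA _; exact: lebesgue_measure_affine.
rewrite ge0_integral_mscale//=; congr (_ * _).
by rewrite ge0_integral_pushforward.
Qed.

End affine.

(** * The Gamma function *)

Section gamma.
Context {R : realType}.
Local Notation mu := (@lebesgue_measure R).
Implicit Types a b x t : R.

Lemma continuous_powR_gt0 b x : 0 < x -> {for x, continuous (@powR R ^~ b)}.
Proof.
move=> x0; apply: differentiable_continuous; apply/derivable1_diffP.
by apply: derivable_powR; rewrite in_itv/= x0.
Qed.

(** For [b < 1] the integrand is unbounded at [0]: the fundamental theorem of
    calculus gives the integral over [[1/(n+2), 1]], and monotone convergence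
    the integral over the union of these intervals. *)
Lemma integral_powR01 b : 0 < b ->
  (\int[mu]_(s in `]0%R, 1%R[) (s `^ (b - 1))%:E = (b^-1)%:E)%E.
Proof.
move=> b0.
have mp D : measurable_fun D (fun s : R => (s `^ (b - 1))%:E).
  by apply/measurable_EFinP; apply: measurable_funTS; exact: measurable_powR.
rewrite integral_itv_bndo_bndc//.
pose F n : set R := `[n.+2%:R^-1, 1%R]%classic.
have -> : `]0%R, 1%R]%classic = \bigcup_n F n :> set R.
  apply/seteqP; split => x /=; rewrite !in_itv/=.
    move=> /andP[x0 x1]; have [n _ /(_ n (leqnn n)) h] := near_infty_natSinv_lt (PosNum x0).
    exists n => //; rewrite /F/= in_itv/= x1 andbT (le_trans _ (ltW h))//.
    by rewrite lef_pV2 ?posrE// ler_nat.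
  case=> n _; rewrite /F/= in_itv/= => /andP[h ->]; rewrite andbT.
  by rewrite (lt_le_trans _ h)// invr_gt0.
have h : (fun n => \int[mu]_(x in F n) (x `^ (b - 1))%:E)%E @ \oo --> (b^-1)%:E.
  have -> : (fun n => \int[mu]_(x in F n) (x `^ (b - 1))%:E)%E =
     (fun n => (b^-1 - (n.+2%:R^-1) `^ b / b)%:E).
    apply/funext => n.
    have n1 : (n.+2%:R^-1 : R) < 1 by rewrite invf_lt1// ltr1n.
    have n0 : 0 < (n.+2%:R^-1 : R) by rewrite invr_gt0.
    rewrite (@continuous_FTC2 _ _ (fun x => x `^ b / b))//.
    - by rewrite powR1 div1r -EFinB.
    - apply: continuous_in_subspaceT => x; rewrite inE/= in_itv/= => /andP[nx _].
      by apply: continuous_powR_gt0; exact: lt_le_trans nx.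
    - have cF x : 0 < x -> {for x, continuous (fun x => x `^ b / b)}.
        by move=> x0; apply: continuousM; [exact: continuous_powR_gt0|exact: cst_continuous].
      split.
      + move=> x; rewrite in_itv/= => /andP[nx _].
        have x0 := lt_trans n0 nx.
        by apply: derivableM => //; apply: derivable_powR; rewrite in_itv/= x0.
      + by apply: cvg_at_right_filter; exact: cF.
      + by apply: cvg_at_left_filter; exact: cF.
    - move=> x; rewrite in_itv/= => /andP[nx _].
      have x0 := lt_trans n0 nx.
      rewrite derive1Mr//; last by apply: derivable_powR; rewrite in_itv/= x0.
      rewrite powR_derive1 ?in_itv/= ?x0//.
      by rewrite mulrAC mulfV ?mul1r// gt_eqF.
  apply: cvg_EFin; first by near=> n.
  rewrite -[X in _ --> X]subr0; apply: cvgB; first exact: cvg_cst.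
  rewrite -[X in _ --> X](mul0r b^-1); apply: cvgMl.
  apply: (@cvg_comp _ _ _ (fun n : nat => n.+2%:R^-1 : R) (fun x => x `^ b) _ (0 : R)^'+);
      last exact: powR_cvg0.
  move=> A /= [e /= e0 eA].
  have [n _ hn] := near_infty_natSinv_lt (PosNum e0).
  exists n => // m nm; apply: eA => /=; last by rewrite invr_gt0.
  rewrite sub0r normrN gtr0_norm ?invr_gt0//.
  by rewrite (le_lt_trans _ (hn _ nm))// lef_pV2 ?posrE// ler_nat.
have h2 : (fun n => \int[mu]_(x in F n) (x `^ (b - 1))%:E)%E @ \oo --> (\int[mu]_(s in
    \bigcup_n F n) (s `^ (b - 1))%:E)%E.
  apply: ge0_nondecreasing_set_cvg_integral => //.
  - apply/nondecreasing_seqP => n; apply/subsetPset => x; rewrite /F/= !in_itv/= =>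
      /andP[nx ->].
    by rewrite andbT (le_trans _ nx)// lef_pV2 ?posrE// ler_nat.
  - by move=> n; exact: measurable_itv.
  - by move=> n; exact: mp.
  - by move=> n x _; rewrite lee_fin powR_ge0.
by rewrite -(cvg_lim _ h2)// -(cvg_lim _ h).
Unshelve. all: by end_near.
Qed.

(** [Gamma] is the real part of this integral, hence [0] by convention if the
    integral were infinite; Tonelli's theorem speaks of the integral itself. *)
Definition Gammae (x : R) : \bar R :=
  (\int[mu]_(t in `]0%R, +oo[) (t `^ (x - 1) * expR (- t))%:E)%E.

Lemma measurable_gamma_integrand D x : measurable_fun D (fun t : R =>
    t `^ (x - 1) * expR (- t)).
Proof.
apply: measurable_funTS; apply: measurable_funM; first exact: measurable_powR.
by apply: measurableT_comp; [exact: measurable_expR|exact: oppr_measurable].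
Qed.

Lemma Gammae_ge0 x : (0 <= Gammae x)%E.
Proof. by apply: integral_ge0 => t _; rewrite lee_fin mulr_ge0 ?powR_ge0 ?expR_ge0. Qed.

(** Below [1] the integrand is at most [t ^ (x - 1)]; above [1] it is at most a
    constant times the exponential density of rate [1/2]. *)
Lemma Gammae_lty x : 0 < x -> (Gammae x < +oo)%E.
Proof.
move=> x0.
pose n := (Num.truncn x).+1.
have xn : x - 1 <= n%:R by rewrite lerBlDr (le_trans (ltW (truncnS_gt _)))// lerDl.
have mg D := @measurable_gamma_integrand D x.
have hsplit : `]0%R, +oo[%classic = `]0%R, 1%R[ `|` `[1%R, +oo[%classic :> set R.
  by rewrite -itv_bndbnd_setU// bnd_simp.
rewrite /Gammae hsplit ge0_integral_setU//=; last 3 first.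
- by apply/measurable_EFinP; exact: mg.
- by move=> t _; rewrite lee_fin mulr_ge0 ?powR_ge0 ?expR_ge0.
- by apply/disj_setPS => t [] /=; rewrite !in_itv/= => /andP[_ +] /andP[+ _]; lra.
apply: lte_add_pinfty.
  apply: (@le_lt_trans _ _ (x^-1)%:E); last exact: ltry.
  rewrite -integral_powR01//; apply: ge0_le_integral => //.
  - by move=> t _; rewrite lee_fin mulr_ge0 ?powR_ge0 ?expR_ge0.
  - by apply/measurable_EFinP; exact: mg.
  - by apply/measurable_EFinP; apply: measurable_funTS; exact: measurable_powR.
  - move=> t; rewrite /= in_itv/= => /andP[t0 _].
    by rewrite lee_fin ler_piMr ?powR_ge0// -expR0 ler_expR oppr_le0 ltW.
(* The term of order n of the exponential series of t/2 yields t^n <= C e^(t/2). *)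
pose C : R := n`!%:R * 2 ^+ n.
have hC t : 1 <= t -> t `^ (x - 1) * expR (- t) <= C * 2 * exponential_pdf 2^-1 t.
  move=> t1; rewrite exponential_pdfE; last by lra.
  have t0 : 0 <= t by lra.
  rewrite -!mulrA [2 * _]mulrA divff ?pnatr_eq0// mul1r.
  have h1 : t `^ (x - 1) <= t ^+ n by rewrite -powR_mulrn//; exact: ler_powR.
  have h2 : (t / 2) ^+ n / n`!%:R <= expR (t / 2).
    have := @expR_ge1Dxn R (t/2) n.-1; rewrite prednK// => /(_ _); have : 0 <= t / 2 by lra.
    by move=> h /(_ h); apply: le_trans; rewrite lerDr.
  rewrite (_ : expR (- t) = expR (- 2^-1 * t) / expR (t / 2)); last first.
    by rewrite -expRN -expRD; congr expR; lra.
  rewrite [expR (- 2^-1 * t) / _]mulrC [leLHS]mulrA [leRHS]mulrA ler_wpM2r ?expR_ge0//.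
  rewrite ler_pdivrMr ?expR_gt0// (le_trans h1)//.
  move: h2; rewrite expr_div_n ler_pdivrMr ?ltr0n ?fact_gt0// ler_pdivrMr ?exprn_gt0//.
  by rewrite -mulrA [leRHS]mulrC.
apply: (@le_lt_trans _ _ (\int[mu]_(t in `[1%R, +oo[) ((C * 2)%:E * (exponential_pdf 2^-1
    t)%:E))%E).
  apply: ge0_le_integral => //.
  - by move=> t _; rewrite lee_fin mulr_ge0 ?powR_ge0 ?expR_ge0.
  - by apply/measurable_EFinP; exact: mg.
  - apply/measurable_EFinP; apply: measurable_funM => //; apply: measurable_funTS;
      exact: measurable_exponential_pdf.
  - by move=> t; rewrite /= in_itv/= andbT => t1; rewrite -EFinM lee_fin hC.
have C0 : 0 <= C * 2 by rewrite !mulr_ge0// ?exprn_ge0.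
apply: (@le_lt_trans _ _ (\int[mu]_t ((C * 2)%:E * (exponential_pdf 2^-1 t)%:E))%E).
  apply: ge0_subset_integral => //.
  - apply/measurable_EFinP; apply: measurable_funM => //; exact: measurable_exponential_pdf.
  - by move=> t _; rewrite -EFinM lee_fin mulr_ge0// exponential_pdf_ge0.
rewrite ge0_integralZl//.
- by rewrite integral_exponential_pdf ?invr_gt0// mule1 ltry.
- by apply/measurable_EFinP; exact: measurable_exponential_pdf.
- by move=> t _; rewrite lee_fin exponential_pdf_ge0.
Qed.
End gamma.

(** * Euler's beta integral *)

Section beta.
Context {R : realType}.
Local Notation mu := (@lebesgue_measure R).
Implicit Types a b x t : R.

Lemma GammaE x : 0 < x -> ((Gamma x)%:E = Gammae x)%E.
Proof.
move=> x0; rewrite /Gamma /Rintegral fineK//.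
by rewrite ge0_fin_numE ?Gammae_ge0//; exact: Gammae_lty.
Qed.

(** Keep only the part of the integral over [[M, M + 1]].  Since [M] is
    arbitrary, [Gamma] outgrows every geometric sequence, which makes the
    Mittag-Leffler series entire. *)
Lemma le_Gamma x M : 1 <= x -> 0 < M -> M `^ (x - 1) * expR (- (M + 1)) <= Gamma x.
Proof.
move=> x1 M0; rewrite -lee_fin GammaE; last by rewrite (lt_le_trans _ x1).
have -> : ((M `^ (x - 1) * expR (- (M + 1)))%:E =
    \int[mu]_(t in `[M, (M + 1)%R]) (M `^ (x - 1) * expR (- (M + 1)))%:E)%E.
  rewrite integral_cst//= lebesgue_measure_itv/= lte_fin ltrDl ltr01 -EFinB.
  by rewrite addrAC subrr add0r mule1.
apply: (@le_trans _ _ (\int[mu]_(t in `[M, (M + 1)%R]) (t `^ (x - 1) * expR (- t))%:E)%E).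
  apply: ge0_le_integral => //.
  - by move=> t _; rewrite lee_fin mulr_ge0 ?powR_ge0 ?expR_ge0.
  - by apply/measurable_EFinP; exact: measurable_gamma_integrand.
  - move=> t; rewrite /= in_itv/= => /andP[Mt tM].
    rewrite lee_fin ler_pM ?powR_ge0 ?expR_ge0//; last by rewrite ler_expR lerN2.
    by rewrite ge0_ler_powR ?nnegrE// ?subr_ge0// ltW// (lt_le_trans M0).
apply: ge0_subset_integral => //.
- by apply/measurable_EFinP; exact: measurable_gamma_integrand.
- by move=> t _; rewrite lee_fin mulr_ge0 ?powR_ge0 ?expR_ge0.
- by move=> t /=; rewrite !in_itv/= andbT => /andP[Mt _]; exact: lt_le_trans Mt.
Qed.

(** The power function extended by zero: integrals over the half-line and over
    the moving interval from [0] to [t] become integrals over the line, to which translation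
    and Tonelli's theorem apply without a change of domain. *)
Definition kpow a (s : R) : R := if 0 < s then s `^ (a - 1) else 0.

Lemma measurable_kpow a : measurable_fun setT (kpow a).
Proof.
by apply: measurable_fun_ifT => //; exact: measurable_fun_ltr.
Qed.

Lemma kpow_ge0 a s : 0 <= kpow a s.
Proof. by rewrite /kpow; case: ifP => // _; exact: powR_ge0. Qed.

(** Euler's beta integral on the interval from [0] to [t], in the convolution
    form in which it occurs in fractional integrals. *)
Definition betaint a b t : \bar R :=
  (\int[mu]_(s in `]0%R, t[) ((t - s) `^ (a - 1) * s `^ (b - 1))%:E)%E.

Lemma betaint_kpow a b t : (betaint a b t = \int[mu]_s (kpow a (t - s) * kpow b s)%:E)%E.
Proof.
rewrite /betaint integral_mkcond; apply: eq_integral => s _; rewrite patchE /kpow.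
case: ifPn => [|]; first by rewrite inE/= in_itv/= => /andP[-> st]; rewrite subr_gt0 st.
rewrite notin_setE /= in_itv/= => /negP; rewrite negb_and subr_gt0 =>
    /orP[/negbTE ->|/negbTE ->].
  by rewrite mulr0.
by rewrite mul0r.
Qed.

Lemma measurable_kpowB a t : measurable_fun setT (fun s : R => kpow a (t - s)).
Proof.
by apply: (measurableT_comp (measurable_kpow a)); exact: measurable_funB.
Qed.

Lemma betaint_scale a b t : 0 < t -> (betaint a b t = (t `^ (a + b - 1))%:E * betaint a b 1)%E.
Proof.
move=> t0; rewrite !betaint_kpow.
rewrite (ge0_integral_affine 0 t0); last 2 first.
- by apply/measurable_EFinP; apply: measurable_funM;
    [exact: measurable_kpowB|exact: measurable_kpow].
- by move=> s; rewrite lee_fin mulr_ge0 ?kpow_ge0.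
have kt c s : kpow c (t * s) = t `^ (c - 1) * kpow c s.
  rewrite /kpow pmulr_rgt0//; case: ifPn => [s0|]; last by rewrite mulr0.
  by rewrite powRM// ltW.
transitivity (t%:E * \int[mu]_s ((t `^ (a - 1) * t `^ (b - 1))%:E * (kpow a (1 - s) * kpow b
    s)%:E))%E.
  congr (_ * _)%E; apply: eq_integral => s _; rewrite addr0.
  have -> : t - t * s = t * (1 - s) by rewrite mulrBr mulr1.
  by rewrite !kt -EFinM mulrACA.
rewrite ge0_integralZl//.
- rewrite muleA -EFinM; congr (_%:E * _)%E.
  rewrite -{1}(powRr1 (ltW t0)) -!powRD ?(gt_eqF t0) ?implybT//.
  by congr (_ `^ _); lra.
- by apply/measurable_EFinP; apply: measurable_funM;
    [exact: measurable_kpowB|exact: measurable_kpow].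
- by move=> s _; rewrite lee_fin mulr_ge0 ?kpow_ge0.
- by rewrite lee_fin mulr_ge0 ?powR_ge0.
Qed.

Lemma Gammae_kpow a : (Gammae a = \int[mu]_s (kpow a s * expR (- s))%:E)%E.
Proof.
rewrite /Gammae integral_mkcond; apply: eq_integral => s _; rewrite patchE /kpow.
rewrite mem_setE in_itv/= andbT; case: ifPn => //; by rewrite mul0r.
Qed.

Lemma measurable_kpow_exp a : measurable_fun setT (fun s : R => kpow a s * expR (- s)).
Proof.
apply: measurable_funM; first exact: measurable_kpow.
by apply: measurableT_comp; [exact: measurable_expR|exact: oppr_measurable].
Qed.

(** Euler's identity [B(a, b) Gamma(a + b) = Gamma(a) Gamma(b)]: integrate
    [(u - s) ^ (a - 1) s ^ (b - 1) exp(- u)] over [0 < s < u] in both orders.  With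
    [s] fixed, translation by [s] splits off [Gamma(a)]; with [u] fixed, scaling by
    [u] splits off [B(a, b) u ^ (a + b - 1)]. *)
Lemma betaint_Gammae a b : 0 < a -> 0 < b ->
  (betaint a b 1 * Gammae (a + b) = Gammae a * Gammae b)%E.
Proof.
move=> a0 b0.
pose h (z : R * R) : \bar R := (kpow a (z.2 - z.1) * kpow b z.1 * expR (- z.2))%:E.
have mexp : measurable_fun setT (fun s : R => expR (- s)).
  by apply: measurableT_comp; [exact: measurable_expR|exact: oppr_measurable].
have mh : measurable_fun setT h.
  apply/measurable_EFinP; apply: measurable_funM; last exact: (measurableT_comp mexp).
  apply: measurable_funM; last exact: (measurableT_comp (measurable_kpow b)).
  apply: (measurableT_comp (measurable_kpow a)); exact: measurable_funB.
have h0 z : (0 <= h z)%E by rewrite lee_fin !mulr_ge0 ?kpow_ge0 ?expR_ge0.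
have L : (\int[mu]_s \int[mu]_u h (s, u) = Gammae a * Gammae b)%E.
  transitivity (\int[mu]_s (Gammae a * (kpow b s * expR (- s))%:E))%E.
    apply: eq_integral => s _.
    rewrite (@ge0_integral_affine _ 1 s) ?mul1e//; last first.
      exact: (measurableT_comp mh (pair1_measurable s)).
    rewrite Gammae_kpow -ge0_integralZr//.
    - apply: eq_integral => u _; rewrite /h/= mul1r addrK -EFinM; congr EFin.
      by rewrite opprD expRD; ring.
    - by apply/measurable_EFinP; exact: measurable_kpow_exp.
    - by move=> u _; rewrite lee_fin mulr_ge0 ?kpow_ge0 ?expR_ge0.
    - by rewrite lee_fin mulr_ge0 ?kpow_ge0 ?expR_ge0.
  rewrite ge0_integralZl//.
  - by rewrite -Gammae_kpow.
  - by apply/measurable_EFinP; exact: measurable_kpow_exp.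
  - by move=> u _; rewrite lee_fin mulr_ge0 ?kpow_ge0 ?expR_ge0.
  - exact: Gammae_ge0.
rewrite -L fubini_tonelli//.
have betaint0 : (0 <= betaint a b 1)%E.
  by apply: integral_ge0 => s _; rewrite lee_fin mulr_ge0 ?powR_ge0.
rewrite [Gammae (a + b)]Gammae_kpow -ge0_integralZl//; last 2 first.
- by apply/measurable_EFinP; exact: measurable_kpow_exp.
- by move=> u _; rewrite lee_fin mulr_ge0 ?kpow_ge0 ?expR_ge0.
apply: eq_integral => u _; rewrite /h/=.
under eq_integral do rewrite EFinM.
rewrite ge0_integralZr//; last 2 first.
- by apply/measurable_EFinP; apply: measurable_funM;
    [exact: measurable_kpowB|exact: measurable_kpow].
- by move=> s _; rewrite lee_fin mulr_ge0 ?kpow_ge0.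
rewrite -betaint_kpow; have [u0|u0] := ltP 0 u.
  by rewrite (betaint_scale _ _ u0) [kpow _ _]/kpow u0 EFinM muleCA -muleA.
rewrite [kpow _ _]/kpow ltNge u0/= mul0r mule0.
rewrite [betaint _ _ u](_ : _ = 0%E) ?mul0e//.
by rewrite /betaint set_itv_ge ?integral_set0// bnd_simp -leNgt.
Qed.

(** For [1 <= x] this is [le_Gamma] with [M = 1]; for [x < 1] positivity comes
    from Euler's identity with [B(x, 1) >= 1]. *)
Lemma Gammae_gt0 x : 0 < x -> (0 < Gammae x)%E.
Proof.
move=> x0; have [x1|x1] := leP 1 x.
  rewrite -GammaE// lte_fin (lt_le_trans _ (@le_Gamma x 1 _ _))//.
rewrite lt0e Gammae_ge0 andbT; apply/eqP => G0.
have := @betaint_Gammae x 1 x0 ltr01; rewrite G0 mul0e.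
move=> /eqP; rewrite mule_eq0 => /orP[|]; last first.
  rewrite -GammaE ?addr_gt0// eqe gt_eqF// (lt_le_trans _ (@le_Gamma _ 1 _ _))//.
  by rewrite lerDr ltW.
apply/negP; rewrite gt_eqF//.
apply: (@lt_le_trans _ _ 1%E) => //.
have {1}-> : (1%E = \int[mu]_(t in `]0%R, 1%R[) 1%:E :> \bar R)%E.
  rewrite integral_cst//= lebesgue_measure_itv/= lte_fin ltr01.
  by rewrite mul1e oppr0 adde0.
apply: ge0_le_integral => //.
- apply/measurable_EFinP; apply: measurable_funTS; apply: measurable_funM.
    by apply: (measurableT_comp (measurable_powR _)); exact: measurable_funB.
  exact: measurable_powR.
- move=> t; rewrite /= in_itv/= => /andP[t0 t1]; rewrite lee_fin subrr powRr0 mulr1.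
  rewrite -[leLHS](powRr0 (1 - t)); apply: ger_powR; last by lra.
  by apply/andP; split; lra.
Qed.

Lemma Gamma_gt0 x : 0 < x -> 0 < Gamma x.
Proof. by move=> x0; rewrite -lte_fin GammaE// Gammae_gt0. Qed.

Lemma betaintE a b t : 0 < a -> 0 < b -> 0 < t ->
  (betaint a b t = (t `^ (a + b - 1) * (Gamma a * Gamma b / Gamma (a + b)))%:E)%E.
Proof.
move=> a0 b0 t0; have ab0 := addr_gt0 a0 b0.
rewrite betaint_scale// EFinM; congr (_ * _)%E.
have := betaint_Gammae a0 b0; rewrite -!GammaE// -EFinM.
have : (0 <= betaint a b 1)%E.
  by apply: integral_ge0 => s _; rewrite lee_fin mulr_ge0 ?powR_ge0.
case: (betaint a b 1) => [r _|_|//].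
  by rewrite -EFinM => -[<-]; rewrite mulfK// gt_eqF// Gamma_gt0.
by rewrite mulyr gtr0_sg ?Gamma_gt0// mul1e.
Qed.

Lemma Gamma1 : Gamma 1 = 1 :> R.
Proof.
apply: EFin_inj; rewrite GammaE// /Gammae.
transitivity (\int[mu]_(t in `[0%R, +oo[) (exponential_pdf 1 t)%:E)%E.
  rewrite integral_itv_obnd_cbnd; last first.
    by apply/measurable_EFinP; exact: measurable_gamma_integrand.
  apply: eq_integral => t; rewrite inE/= in_itv/= andbT => t0.
  by rewrite subrr powRr0 mul1r exponential_pdfE// mul1r mulN1r.
rewrite -(integral_exponential_pdf (@ltr01 R)) integral_mkcond.
apply: eq_integral => t _; rewrite patchE; case: ifPn => //.
by rewrite notin_setE /= in_itv/= andbT => /negP; rewrite -ltNge => /lt0_exponential_pdf ->.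
Qed.

(** The case [a = 1] of Euler's identity, since [B(1, x) = 1 / x]. *)
Lemma GammaS x : 0 < x -> Gamma (x + 1) = x * Gamma x.
Proof.
move=> x0; have := @betaintE 1 x 1 ltr01 x0 ltr01.
have -> : betaint 1 x 1 = (x^-1)%:E.
  rewrite -integral_powR01//; apply: eq_integral => s _.
  by rewrite subrr powRr0 mul1r.
rewrite powR1 Gamma1 !mul1r [1 + x]addrC => -[] /(congr1 (fun z => z * (x * Gamma (x + 1)))).
have G := Gamma_gt0 x0; have G1 := @Gamma_gt0 (x + 1) (addr_gt0 x0 ltr01).
have -> : x^-1 * (x * Gamma (x + 1)) = Gamma (x + 1) by field; rewrite gt_eqF.
by move=> ->; field; rewrite gt_eqF.
Qed.

End beta.

(** * An inequality for functions with integrable derivative *)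

Section perron.
Context {R : realType}.
Local Notation mu := (@lebesgue_measure R).
Implicit Types a b x y : R.

(** On [[c, b]] with [a < c] the maximum of [f] can only be attained at [b], because
    from any other point [f] increases strictly to the right; then let [c] tend to
    [a]. *)
Lemma le_of_right_increasing (f : R -> R) a b : a < b ->
  {within `[a, b], continuous f} ->
  (forall x, a < x < b -> exists2 d, 0 < d & forall y, x < y < x + d -> y <= b -> f x < f y) ->
  f a <= f b.
Proof.
move=> ab cf incr.
have fcb c : a < c < b -> f c <= f b.
  move=> /andP[ac cb].
  have [|x xcb xmax] := @EVT_max R f c b (ltW cb).
    apply: continuous_subspaceW cf => z /=; rewrite !in_itv/= => /andP[cz ->].
    by rewrite andbT (le_trans (ltW ac)).
  suff -> : b = x by apply: xmax; rewrite in_itv/= lexx ltW.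
  move: xcb; rewrite in_itv/= => /andP[cx]; rewrite le_eqVlt => /predU1P[->//|xb].
  have [|d d0 fd] := incr x; first by rewrite (lt_le_trans ac).
  pose y := Num.min (x + d / 2) b.
  have xy : x < y by rewrite lt_min xb andbT; lra.
  have yb : y <= b by rewrite ge_min lexx orbT.
  have := fd y; rewrite xy/= => /(_ _ yb) fxy.
  have /fxy : y < x + d by rewrite gt_min; apply/orP; left; lra.
  by rewrite ltNge xmax// in_itv/= yb andbT (le_trans cx)// ltW.
have /continuous_within_itvP[//|_ fa _] := cf.
apply: (cvgr_to_le fa).
near=> c; apply: fcb; apply/andP; split; near: c.
  exact: nbhs_right_gt.
exact: nbhs_right_lt.
Unshelve. all: by end_near.
Qed.

Let le_mu (A B : set R) : measurable A -> measurable B -> A `<=` B -> (mu A <= mu B)%E.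
Proof. by move=> mA mB AB; rewrite le_measure ?inE. Qed.

(** A form of the Vitali-Caratheodory theorem.  The level set where [p] lies
    between [k eta] and [(k + 1) eta] is covered by an open set [V k] of almost the same
    measure, and [g] is the sum of the [(k + 1) eta] times the indicator of [V k].
    Openness makes [g] at least [(k + 1) eta > p x] near each point [x] of the level
    set, so that the indefinite integral of [g] has slope greater than [p x] at [x]. *)
Lemma integral_majorant (p : R -> R) a b eps : a < b -> 0 < eps ->
  (forall x, 0 <= p x) -> measurable_fun setT p ->
  mu.-integrable `[a, b] (EFin \o p) ->
  exists g : R -> R,
    [/\ mu.-integrable `[a, b] (EFin \o g),
        \int[mu]_(x in `[a, b]) g x <= \int[mu]_(x in `[a, b]) p x + eps &
        forall x, a <= x < b -> exists r, p x < r /\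
          exists2 d, 0 < d & forall y, x < y < x + d -> y <= b ->
          r * (y - x) <= parameterized_integral mu a y g - parameterized_integral mu a x g].
Proof.
move=> ab eps0 p0 mp ip.
have ba0 : 0 < b - a by rewrite subr_gt0.
pose D : set R := `[a, b]%classic.
have mD : measurable D by exact: measurable_itv.
have muD : mu D = (b - a)%:E by rewrite lebesgue_measure_itv/= lte_fin ab EFinB.
(* Half of eps pays for rounding p up to a multiple of eta on [a, b], the other
   half for the open covers. *)
pose eta := eps / 2 / (b - a).
have eta0 : 0 < eta by rewrite !divr_gt0.
pose E k : set R := D `&` p @^-1` `[k%:R * eta, k.+1%:R * eta[%classic.
have mE k : measurable (E k).
  by apply: measurableI => //; rewrite -[X in measurable X]setTI; apply: mp.
have muE k : (mu (E k) < +oo)%E.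
  by apply: (@le_lt_trans _ _ (mu D)); [apply: le_mu => // x []|rewrite muD ltry].
pose w k := k.+1%:R * eta.
have w0 k : 0 < w k by rewrite mulr_gt0// ltr0n.
pose del k := eps / 2 / (2 ^ k.+1)%:R / w k.
have del0 k : 0 < del k by rewrite !divr_gt0// ltr0n expn_gt0.
have /choice[V VP] : forall k, exists V : set R, [/\ open V,
    E k `<=` V & (mu (V `\` E k) < (del k)%:E)%E].
  by move=> k; exact: (lebesgue_regularity_outer (mE k) (muE k) (del0 k)).
have mV k : measurable (V k) by have [oV _ _] := VP k; exact: open_measurable.
have mI k A : measurable_fun A (\1_(V k) : R -> R) by exact: (@measurable_indic _ _ R A _ (mV
    k)).
pose u (x : R) : \bar R := (\sum_(k <oo) (w k * \1_(V k) x)%:E)%E.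
have wV0 k x : (0 <= (w k * \1_(V k) x)%:E)%E by rewrite lee_fin mulr_ge0// ltW.
have mwV k : measurable_fun setT (fun x => (w k * \1_(V k) x)%:E).
  by apply/measurable_EFinP; apply: measurable_funM => //; exact: mI.
have u0 x : (0 <= u x)%E by apply: nneseries_ge0 => k _ _.
have mu_u : measurable_fun setT u.
  by apply: ge0_emeasurable_sum.
have Eex x : D x -> exists k, E k x.
  move=> Dx; exists (Num.truncn (p x / eta)); split => //=; rewrite in_itv/=.
  by rewrite -ler_pdivlMr// -ltr_pdivrMr// truncn_itv// divr_ge0// ltW.
have intu : (\int[mu]_(x in D) u x <= \int[mu]_(x in D) (p x)%:E + eps%:E)%E.
  rewrite integral_nneseries//; last first.
    by move=> k; apply: measurable_funTS; exact: mwV.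
  apply: (@le_trans _ _ (\sum_(k <oo) (\int[mu]_(x in E k) (p x + eta)%:E + (eps / 2 / (2 ^
      k.+1)%:R)%:E))%E).
    apply: lee_nneseries => [k _ _|k _]; first by apply: integral_ge0 => x _.
    under eq_integral do rewrite EFinM.
    rewrite ge0_integralZl//; last 2 first.
    - by apply/measurable_EFinP; exact: mI.
    - by rewrite lee_fin ltW.
    rewrite integral_indic//; last exact: mV.
    apply: (@le_trans _ _ ((w k)%:E * (mu (E k) + (del k)%:E))%E).
      apply: lee_wpmul2l; first by rewrite lee_fin ltW.
      have [_ EV hV] := VP k.
      apply: (@le_trans _ _ (mu (V k))); first by apply: le_mu => //; exact: measurableI.
      rewrite -(setDUK EV) measureU; [by rewrite leeD2l// ltW|exact: mE|exact: (measurableD (mV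
          k) (mE k))|by rewrite setDIK].
    rewrite ge0_muleDr ?measure_ge0 ?lee_fin ?(ltW (del0 k))//.
    rewrite -EFinM [w k * del k]mulrC divfK ?gt_eqF//; apply: leeD2r.
    have -> : ((w k)%:E * mu (E k) = \int[mu]_(x in E k) (w k)%:E)%E by rewrite integral_cst;
        [|exact: mE].
    apply: ge0_le_integral => //; first exact: mE.
    - by move=> x _; rewrite lee_fin ltW.
    - by apply/measurable_EFinP; apply: measurable_funTS; exact: measurable_funD.
    - move=> x [_ /=]; rewrite in_itv/= => /andP[h _]; rewrite lee_fin /w.
      by rewrite -natr1 mulrDl mul1r lerD2r.
  apply: le_trans; first apply: epsilon_trick.
  - by move=> k; apply: integral_ge0 => x _; rewrite lee_fin addr_ge0// ltW.
  - by rewrite ltW// divr_gt0.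
  have tE : trivIset setT E.
    apply/trivIsetP => i j _ _ ij; apply/seteqP; split => // x [[_ /=]].
    rewrite in_itv/= => /andP[i1 i2] [_ /=]; rewrite in_itv/= => /andP[j1 j2].
    have := le_lt_trans i1 j2; have := le_lt_trans j1 i2.
    rewrite !ltr_pM2r// !ltr_nat !ltnS => ji ij'.
    by move: ij; rewrite eqn_leq ij' ji.
  rewrite -ge0_integral_bigcup//; last 2 first.
  - by apply/measurable_EFinP; apply: measurable_funTS; exact: measurable_funD.
  - by move=> x _; rewrite lee_fin addr_ge0// ltW.
  apply: (@le_trans _ _ (\int[mu]_(x in D) (p x + eta)%:E + (eps / 2)%:E)%E).
    apply: leeD2r; apply: ge0_subset_integral => //.
    - by apply: bigcup_measurable => k _; exact: mE.
    - by apply/measurable_EFinP; apply: measurable_funTS; exact: measurable_funD.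
    - by move=> x _; rewrite lee_fin addr_ge0// ltW.
    - by move=> x [k _ []].
  under eq_integral do rewrite EFinD.
  rewrite ge0_integralD//; last 3 first.
  - by move=> x _; rewrite lee_fin.
  - by apply/measurable_EFinP; apply: measurable_funTS.
  - by move=> x _; rewrite lee_fin ltW.
  have -> : (\int[mu]_(x in D) eta%:E = (eta * (b - a))%:E)%E by rewrite integral_cst;
      [by rewrite [RHS]EFinM -muD|exact: mD].
  rewrite -addeA leeD2l// -EFinD lee_fin.
  by rewrite /eta divfK ?gt_eqF// -splitr.
have iu : mu.-integrable D u.
  apply/integrableP; split; first exact: measurable_funTS.
  under eq_integral do rewrite gee0_abs//.
  apply: (le_lt_trans intu); apply: lte_add_pinfty; last exact: ltry.
  by case/integrableP : ip => _; under eq_integral do rewrite gee0_abs ?lee_fin//.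
(* u may be infinite on a null set, which does not change its integrals. *)
pose g x := fine (u x).
have mg : measurable_fun D g.
  by apply: measurableT_comp => //; exact: measurable_funTS.
have aeg : ae_eq mu D (EFin \o g) u.
  have := integrable_ae (mD : measurable (D : set (measurableTypeR R))) iu; apply: filterS =>
      x /= h Dx.
  by rewrite /g fineK// h.
have gE A : measurable A -> A `<=` D -> (\int[mu]_(x in A) (g x)%:E = \int[mu]_(x in A) u x)%E.
  move=> mA AD; apply: ge0_ae_eq_integral => //.
  - by apply/measurable_EFinP; exact: measurable_funS AD mg.
  - exact: measurable_funTS.
  - by move=> x _; rewrite lee_fin fine_ge0.
  - exact: ae_eq_subset aeg.
have ig : mu.-integrable D (EFin \o g).
  apply/integrableP; split; first exact/measurable_EFinP.
  under eq_integral do rewrite /= ger0_norm ?fine_ge0//.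
  rewrite gE//; case/integrableP : iu => _.
  by under eq_integral do rewrite gee0_abs//.
exists g; split => //.
  rewrite -lee_fin EFinD.
  rewrite /Rintegral !fineK; [by rewrite gE| |]; exact: integrable_fin_num.
move=> x /andP[ax xb].
have [|k Ekx] := Eex x; first by rewrite /D/= in_itv/= ax ltW.
have [oV EV _] := VP k.
exists (w k); split; first by case: Ekx => _ /=; rewrite in_itv/= => /andP[].
have /nbhs_ballP[d /= d0 dV] : nbhs x (V k) by apply: open_nbhs_nbhs; split => //; exact: EV.
exists d => // y /andP[xy yd] yb.
have subxy : `]x, y] `<=` D.
  by move=> z /=; rewrite /D/= !in_itv/= => /andP[xz zy];
      rewrite (le_trans ax (ltW xz)) (le_trans zy).
have igy : mu.-integrable `[a, y] (EFin \o g).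
  by apply: integrableS ig => // z /=; rewrite /D/= !in_itv/= => /andP[-> zy];
      rewrite (le_trans zy).
rewrite /parameterized_integral Rintegral_itvB//; last by rewrite bnd_simp ltW.
rewrite -lee_fin /Rintegral fineK; last first.
  apply: integrable_fin_num => //; apply: integrableS ig => //.
rewrite gE//.
apply: (@le_trans _ _ (\int[mu]_(z in `]x, y]) (w k)%:E)%E).
  by rewrite integral_cst//= lebesgue_measure_itv/= lte_fin xy -EFinB -EFinM.
apply: ge0_le_integral => //.
- by move=> z _; rewrite lee_fin ltW.
- exact: measurable_funTS.
move=> z /=; rewrite in_itv/= => /andP[xz zy].
apply: (@le_trans _ _ (w k * \1_(V k) z)%:E).
  rewrite indicE mem_set ?mulr1//; apply: dV; rewrite /ball/= distrC gtr0_norm ?subr_gt0//.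
  by rewrite ltrBlDl (le_lt_trans zy).
rewrite /u (@nneseriesD1 _ _ k)//.
  by rewrite leeDl// nneseries_ge0.
Unshelve. all: exact: 0%N.
Qed.

Lemma derivable_slope_lt (F : R -> R) x r : derivable F x 1 -> derive1 F x < r ->
  exists2 d, 0 < d & forall y, `|y - x| < d -> y != x -> (F y - F x) / (y - x) < r.
Proof.
move=> dF; rewrite derive1E => Fr.
have cF : h^-1 *: (F (h *: 1 + x) - F x) @[h --> 0^'] --> 'D_1 F x := dF.
have [d /= d0 Fd] := cvgr_lt _ cF _ Fr.
exists d => // y yxd yx; have /(_ (y - x)) := Fd.
rewrite /ball/= sub0r normrN subr_eq0 => /(_ yxd yx).
by rewrite scaler1 subrK /GRing.scale/= mulrC.
Qed.

(** One half of the fundamental theorem of calculus for a function that is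
    differentiable everywhere, without continuity of the derivative: it is what
    turns mere integrability of the Caputo integrand into information on [F].
    After truncating [h] from below and adding a constant, [integral_majorant]
    gives an indefinite integral with slope greater than that of [F] at every
    point, so their difference is nondecreasing; dominated convergence removes
    the truncation. *)
Lemma sub_le_integral_of_derive_le (F h : R -> R) a b : a < b ->
  {within `[a, b], continuous F} ->
  (forall x, a < x < b -> derivable F x 1 /\ derive1 F x <= h x) ->
  mu.-integrable `]a, b[ (EFin \o h) ->
  F b - F a <= \int[mu]_(x in `]a, b[) h x.
Proof.
move=> ab cF dF ih.
have ba0 : 0 < b - a by rewrite subr_gt0.
pose h1 := h \_ `]a, b[.
have h1E : EFin \o h1 = (EFin \o h) \_ `]a, b[ by rewrite restrict_EFin.
have ih1 : mu.-integrable setT (EFin \o h1) by rewrite h1E; apply: (integrable_mkcond _ _).1.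
have mh1 : measurable_fun setT h1 by have /integrableP[/measurable_EFinP mh _] := ih1;
    exact: mh.
have Ih1 : \int[mu]_(x in `[a, b]) h1 x = \int[mu]_(x in `]a, b[) h x.
  by rewrite /h1 -Rintegral_mkcondr setIidr//; exact: subset_itv_oo_cc.
(* hm m + m is nonnegative, as integral_majorant requires. *)
pose hm (m : nat) x := Num.max (h1 x) (- m%:R).
have hm_abs m x : `|hm m x| <= `|h1 x|.
  rewrite /hm; case: (leP (h1 x) (- m%:R)) => // hx.
  have : 0 <= m%:R :> R by [].
  by move=> m0; rewrite normrN ger0_norm// ler0_norm; lra.
have mhm m : measurable_fun setT (hm m).
  by apply: measurable_maxr => //.
have ihm m : mu.-integrable `[a, b] (EFin \o hm m).
  have ih1ab : mu.-integrable `[a, b] (EFin \o h1) by exact: integrableS ih1.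
  apply: (le_integrable _ _ _ ih1ab) => //.
  - by apply/measurable_EFinP; apply: measurable_funTS; exact: mhm.
  - by move=> x _; rewrite /= lee_fin; exact: hm_abs.
have claim m : F b - F a <= \int[mu]_(x in `[a, b]) hm m x.
  apply/ler_addgt0Pr => eps eps0.
  pose p x := hm m x + m%:R.
  have p0 x : 0 <= p x by rewrite -lerBlDr sub0r /hm le_max lexx orbT.
  have icst : mu.-integrable `[a, b] (EFin \o cst (m%:R : R)).
    apply: continuous_compact_integrable; first exact: segment_compact.
    by apply: continuous_subspaceT => x; exact: cst_continuous.
  have mp : measurable_fun setT p by apply: measurable_funD; [exact: mhm|exact: measurable_cst].
  have ip : mu.-integrable `[a, b] (EFin \o p).
    by have := integrableD _ (ihm m) icst; apply.
  have [g [ig gp gmaj]] := integral_majorant ab eps0 p0 mp ip.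
  pose Phi y := parameterized_integral mu a y g.
  pose Psi y := Phi y - m%:R * y - F y.
  have cPsi : {within `[a, b], continuous Psi}.
    move=> x; apply: cvgB; last exact: cF.
    apply: cvgB; first exact: (parameterized_integral_continuous (ltW ab) ig).
    apply: continuous_subspaceT => {}x; apply: mulrl_continuous.
  have : Psi a <= Psi b.
    apply: le_of_right_increasing ab cPsi _ => x xab.
    have [dFx Fhx] := dF _ xab.
    have [|r [pr [d1 d10 maj]]] := gmaj x; first by case/andP : xab => /ltW -> ->.
    have [|d2 d20 Fd] := @derivable_slope_lt F x (r - m%:R) dFx.
      rewrite (le_lt_trans Fhx)// ltrBrDr (le_lt_trans _ pr)// /p lerD2r /hm le_max.
      by rewrite /h1 patchE mem_set ?lexx//= in_itv/=.
    exists (Num.min d1 d2); first by rewrite lt_min d10.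
    move=> y /andP[xy]; rewrite -ltrBlDl lt_min => /andP[y1 y2] yb.
    have := maj y; rewrite xy -ltrBlDl y1 => /(_ isT yb).
    have := Fd y; rewrite gtr0_norm ?subr_gt0// gt_eqF// ltr_pdivrMr ?subr_gt0// => /(_ y2 isT).
    by rewrite /Psi -/(Phi x) -/(Phi y) mulrBl mulrBr; lra.
  have Phia : Phi a = 0 by rewrite /Phi /parameterized_integral set_itv1 Rintegral_set1.
  have Phib : Phi b <= \int[mu]_(x in `[a, b]) hm m x + m%:R * (b - a) + eps.
    apply: (le_trans gp); rewrite lerD2r RintegralD//.
    by rewrite Rintegral_cst//= lebesgue_measure_itv/= lte_fin ab.
  by rewrite /Psi Phia; lra.
rewrite -Ih1.
have hmcvg : \int[mu]_(x in `[a, b]) hm m x @[m --> \oo] --> \int[mu]_(x in `[a, b]) h1 x.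
  apply/fine_cvg; rewrite fineK; last by apply: integrable_fin_num => //;
      exact: integrableS ih1.
  apply: (@dominated_cvg _ _ _ mu `[a, b] _ (fun m =>
      EFin \o hm m) (EFin \o h1) (abse \o (EFin \o h1))) => //.
  - by move=> m; apply/measurable_EFinP; apply: measurable_funTS; exact: mhm.
  - move=> x _; apply: cvg_near_cst.
    have [n nh] : exists n, `|h1 x| < n%:R.
      by exists (Num.truncn `|h1 x|).+1; exact: truncnS_gt.
    exists n => // m /= nm; congr EFin.
    apply/max_idPl; rewrite lerNl (le_trans (ler_norm _))// normrN (le_trans (ltW nh))//
        ler_nat//.
  - by apply: integrable_abse; exact: integrableS ih1.
  - by move=> m x _; rewrite /= lee_fin; exact: hm_abs.
apply: (cvgr_to_ge hmcvg); exact: nearW.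
Qed.

End perron.

(** * The comparison principle for Caputo derivatives *)

Section comparison.
Context {R : realType}.
Local Notation mu := (@lebesgue_measure R).
Implicit Types (beta t : R) (f : R -> R).

Lemma derivable1_cvg f t : derivable f t 1 -> f x @[x --> t] --> f t.
Proof. by move=> /derivable1_diffP/differentiable_continuous. Qed.

(** The extremum principle: formally, integration by parts gives
    [Gamma(1 - beta)] times the Caputo derivative as
    [t0 ^ (- beta) (f t0 - f 0)] plus the integral of
    [beta (t0 - s) ^ (- beta - 1) (f t0 - f s)], which is nonnegative at a maximum.  As
    the derivative of [f] is only known to be integrable against the kernel, the
    inequality is obtained from [sub_le_integral_of_derive_le] for
    [phi s = - (t0 - s) ^ (- beta) (f t0 - f s)], whose derivative is at most the
    Caputo integrand. *)
Lemma caputo_gt0_at_max beta f t0 : 0 < beta < 1 -> 0 < t0 ->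
  {within `[0, t0], continuous f} -> derivable f t0 1 -> caputo_ex beta f t0 ->
  (forall s, 0 <= s <= t0 -> f s <= f t0) -> f 0 < f t0 -> 0 < caputo beta f t0.
Proof.
move=> /andP[b0 b1] t00 cf dft0; rewrite /caputo_ex /caputo lt_eqF// => -[df ih] fmax f0.
have [cf_in cf0 cft] := (continuous_within_itvP f t00).1 cf.
rewrite mulr_gt0 ?invr_gt0 ?Gamma_gt0 ?subr_gt0//.
pose phi s := - ((t0 - s) `^ (- beta) * (f t0 - f s)).
have phi_left : phi x @[x --> t0^'-] --> phi t0.
  rewrite /phi !subrr mulr0 oppr0.
  have q : (f y - f t0) / (y - t0) @[y --> t0^'-] --> 'D_1 f t0.
    apply/cvgrPdist_lt => e e0.
    have cF : h^-1 *: (f (h *: 1 + t0) - f t0) @[h --> 0^'] --> 'D_1 f t0 := dft0.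
    move/cvgrPdist_lt : cF => /(_ e e0) [d /= d0 H].
    exists d => // y /= yd yt0.
    have := H (y - t0); rewrite /= sub0r normrN -opprB normrN => /(_ yd).
    by rewrite opprB subr_eq0 lt_eqF// => /(_ isT); rewrite scaler1 subrK /GRing.scale/= mulrC.
  have p : (t0 - y) `^ (1 - beta) @[y --> t0^'-] --> 0.
    apply: (@cvg_comp _ _ _ (fun y => t0 - y) (fun x => x `^ (1 - beta)) _ (0 : R)^'+).
      move=> A /= [d /= d0 H]; exists d => // y /= yd yt0; apply: H => /=;
          last by rewrite subr_gt0.
      by rewrite sub0r normrN.
    by apply: powR_cvg0; rewrite subr_gt0.
  have /(_ _) pq := cvgM p q; have /(_ _) := cvgN pq.
  rewrite mul0r oppr0 => npq; apply: cvg_trans npq; apply: near_eq_cvg.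
  near=> y; have yt : 0 < t0 - y by rewrite subr_gt0; near: y; exact: nbhs_left_lt.
  rewrite -[LHS]/(- ((t0 - y) `^ (1 - beta) * ((f y - f t0) / (y - t0)))) powRD ?(gt_eqF yt)
      ?implybT// (powRr1 (ltW yt)).
  by rewrite /phi; field; rewrite lt_eqF// -opprB oppr_lt0.
have dpow s : s < t0 -> is_derive s 1 (fun s =>
    (t0 - s) `^ (- beta)) (beta * (t0 - s) `^ (- beta - 1)).
  move=> st; have st0 : 0 < t0 - s by rewrite subr_gt0.
  have dB : is_derive s 1 (fun s => t0 - s) (-1).
    exact: (is_derive_eq (is_deriveB (is_derive_cst t0 s 1) (is_derive_id s 1)) (sub0r _)).
  have := @is_derive1_comp _ (fun x => x `^ (- beta)) _ s _ _ (is_derive1_powR (- beta) st0) dB.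
  by rewrite mulrN1 mulNr opprK.
have dphi s : 0 < s < t0 -> is_derive s 1 phi
   (- (beta * (t0 - s) `^ (- beta - 1) * (f t0 - f s)) + (t0 - s) `^ (- beta) * derive1 f s).
  move=> /andP[s0 st].
  have dfs : is_derive s 1 f (derive1 f s).
    by rewrite derive1E; apply: DeriveDef => //; apply: df; rewrite s0.
  have dP := dpow _ st.
  have dB : is_derive s 1 (fun s => f t0 - f s) (- derive1 f s).
    exact: (is_derive_eq (is_deriveB (is_derive_cst (f t0) s 1) dfs) (sub0r _)).
  apply: (is_derive_eq (is_deriveN (is_deriveM dP dB))); rewrite /GRing.scale/=; ring.
have cphi : {within `[0, t0], continuous phi}.
  apply/continuous_within_itvP => //; split => //.
    move=> s; rewrite in_itv/= => /dphi[ds _].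
    exact: derivable1_cvg.
  apply: cvgN; apply: cvgM.
    by apply: cvg_at_right_filter; apply: derivable1_cvg; case: (dpow 0 t00).
  by apply: cvgB => //; exact: cvg_cst.
apply: (lt_le_trans _ (sub_le_integral_of_derive_le t00 cphi _ ih)).
  rewrite /phi !subrr mulr0 oppr0 sub0r opprK addr0.
  by rewrite mulr_gt0 ?powR_gt0 ?subr_gt0.
move=> s st; have [ds dE] := dphi _ st; split => //; have /andP[s0 st0] := st.
rewrite derive1E dE /caputo_integrand gerDr oppr_le0 mulr_ge0 ?mulr_ge0 ?powR_ge0 ?(ltW b0)//.
by rewrite subr_ge0 fmax// (ltW s0) (ltW st0).
Unshelve. all: by end_near.
Qed.

(** The comparison principle.  If [f] were positive somewhere, it would be
    positive with positive Caputo derivative at some point: for [beta < 1] at a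
    maximum of [f] on [[0, T]]; for [beta = 1] at a maximum of [f - eps t], where the
    derivative of [f] cannot be nonpositive. *)
Lemma caputo_le0 beta f : 0 < beta <= 1 ->
  {within `[0, +oo[, continuous f} -> f 0 <= 0 ->
  (forall t, 0 < t -> caputo_ex beta f t) ->
  (forall t, 0 < t -> 0 < f t -> caputo beta f t <= 0) ->
  forall t, 0 <= t -> f t <= 0.
Proof.
move=> /andP[b0]; rewrite le_eqVlt => b1 cf f0 exf Hf T T0.
rewrite leNgt; apply/negP => fT.
have {}T0 : 0 < T.
  by rewrite lt_neqAle T0 andbT; apply: contraTneq fT => <-; rewrite -leNgt.
have cfT t : {within `[0, t], continuous f}.
  by apply: continuous_subspaceW cf => x /=; rewrite !in_itv/= andbT => /andP[].
move: b1 => /predU1P[b1|b1].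
  subst beta; pose eps := f T / (2 * T).
  have eps0 : 0 < eps by rewrite divr_gt0// mulr_gt0.
  pose g t := f t - eps * t.
  have [|t1 t1T gmax] := @EVT_max R g 0 T (ltW T0).
    move=> x; apply: cvgB; first exact: cfT.
    by apply: continuous_subspaceT => {}x; exact: mulrl_continuous.
  have gT : g T = f T / 2.
    by rewrite /g /eps; field; rewrite gt_eqF.
  have gt1 : 0 < g t1.
    apply: (@lt_le_trans _ _ (g T)); first by rewrite gT divr_gt0.
    by apply: gmax; rewrite in_itv/= lexx ltW.
  move: t1T; rewrite in_itv/= => /andP[t10 t1T].
  have {}t10 : 0 < t1.
    rewrite lt_neqAle t10 andbT; apply: contraTneq gt1 => <-.
    by rewrite -leNgt /g mulr0 subr0.
  have ft1 : 0 < f t1 by apply: (lt_trans gt1); rewrite /g gtrBl mulr_gt0.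
  have := exf _ t10; rewrite /caputo_ex eqxx => dft1.
  have := Hf _ t10 ft1; rewrite /caputo eqxx => ft1'.
  have [d d0 Fd] := derivable_slope_lt dft1 (le_lt_trans ft1' eps0).
  pose y := Num.max (t1 / 2) (t1 - d / 2).
  have yt1 : y < t1 by rewrite /y gt_max; apply/andP; split; lra.
  have y0 : 0 < y by rewrite /y lt_max; apply/orP; left; lra.
  have yd : `|y - t1| < d.
    rewrite ltr0_norm ?subr_lt0// opprB ltrBlDr -ltrBlDl /y lt_max; apply/orP; right; lra.
  have := Fd y yd; rewrite lt_eqF// => /(_ isT).
  rewrite ltr_ndivrMr ?subr_lt0// => h.
  have := gmax y; rewrite in_itv/= (ltW y0) (le_trans (ltW yt1) t1T) => /(_ isT).
  by rewrite /g leNgt => /negP; apply; lra.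
have [//|t1 t1T fmax] := @EVT_max R f 0 T (ltW T0).
move: (t1T); rewrite in_itv/= => /andP[t10 t1T'].
have ft1 : 0 < f t1 by rewrite (lt_le_trans fT)// fmax// in_itv/= lexx ltW.
have {}t10 : 0 < t1.
  by rewrite lt_neqAle t10 andbT; apply: contraTneq ft1 => <-; rewrite -leNgt.
have := Hf _ t10 ft1; rewrite leNgt => /negP; apply.
apply: caputo_gt0_at_max => //.
- by rewrite b0.
- have := exf (t1 + 1); rewrite /caputo_ex lt_eqF// => H.
  by have [|+ _] := H; [lra|apply; lra].
- exact: exf.
- by move=> s /andP[s0 st]; apply: fmax; rewrite in_itv/= s0 (le_trans st).
- exact: le_lt_trans ft1.
Qed.

End comparison.

(** * Mittag-Leffler series *)

Section mittag_leffler_series.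
Context {R : realType}.
Local Notation mu := (@lebesgue_measure R).
Implicit Types (c : nat -> R) (beta b x t : R).

(** Coefficient sequences of power series with infinite radius of convergence,
    in the form that is stable under term-by-term differentiation. *)
Definition entire c := forall r, 0 < r -> exists C, forall k, `|c k| * r ^+ k <= C.

Lemma entire_cvg_norm c x : entire c -> cvgn (series (fun k => `|c k| * `|x| ^+ k)).
Proof.
move=> ec; pose r := 2 * (`|x| + 1).
have r0 : 0 < r by rewrite mulr_gt0// ltr_wpDl.
have [C cC] := ec r r0.
apply: (@series_le_cvg _ _ (geometric C 2^-1)).
- by move=> n; rewrite mulr_ge0// exprn_ge0.
- move=> n; rewrite /= mulr_ge0// (le_trans _ (cC 0%N))// mulr_ge0// exprn_ge0// ltW//.
- move=> n; rewrite /= exprVn ler_pdivlMr ?exprn_gt0//.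
  apply: le_trans (cC n); rewrite -mulrA ler_wpM2l//.
  rewrite /r exprMn mulrC ler_wpM2l ?exprn_ge0// lerXn2r ?nnegrE//.
  by rewrite lerDl.
- by apply: is_cvg_geometric_series; rewrite ger0_norm// invf_lt1// ltr1n.
Qed.

Lemma entire_cvg c x : entire c -> cvgn (pseries c x).
Proof.
move=> ec; apply: normed_cvg; rewrite /normed_series_of/=.
have := @entire_cvg_norm c x ec.
suff -> : (fun k => `|c k| * `|x| ^+ k) = (fun k => `|c k * x ^+ k|) by [].
by apply/funext => k /=; rewrite normrM normrX.
Qed.

Lemma entire_diffs c : entire c -> entire (pseries_diffs c).
Proof.
move=> ec r r0; have r20 : 0 < 2 * r by rewrite mulr_gt0.
have [C cC] := ec _ r20; exists (C / r) => k.
rewrite /pseries_diffs ler_pdivlMr// normrM normr_nat -!mulrA -exprSr mulrCA.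
apply: le_trans (cC k.+1); rewrite ler_wpM2l// exprMn ler_wpM2r ?exprn_ge0 ?(ltW r0)//.
by rewrite -natrX ler_nat ltnW// ltn_expl.
Qed.

Lemma entire_is_derive c x : entire c ->
  is_derive x (1 : R) (fun x => limn (pseries c x)) (limn (pseries (pseries_diffs c) x)).
Proof.
move=> ec; apply: (@pseries_snd_diffs _ _ (`|x| + 1)); try exact: entire_cvg.
- by apply: entire_cvg; exact: entire_diffs.
- by apply: entire_cvg; do 2! apply: entire_diffs.
- by rewrite [ltRHS]ger0_norm ?addr_ge0// ltrDl.
Qed.

Definition mlcoef beta b : nat -> R := fun k => (Gamma (beta * k%:R + b))^-1.

(** The two-parameter Mittag-Leffler function on the reals.  The second parameter
    is needed because differentiation and fractional integration change it. *)
Definition ML beta b x : R := limn (pseries (mlcoef beta b) x).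

Lemma mlarg_gt0 beta b k : 0 < beta -> 0 < b -> 0 < beta * k%:R + b.
Proof. by move=> b0 c0; rewrite ltr_wpDl// mulr_ge0// ltW. Qed.

Lemma mlcoef_gt0 beta b k : 0 < beta -> 0 < b -> 0 < mlcoef beta b k.
Proof. by move=> b0 c0; rewrite invr_gt0 Gamma_gt0// mlarg_gt0. Qed.

(** Apply [le_Gamma] with [M ^ beta = r].  It requires [beta k + b >= 1]; the finitely
    many remaining indices are absorbed in the additive constant. *)
Lemma mlcoef_entire beta b : 0 < beta -> 0 < b -> entire (mlcoef beta b).
Proof.
move=> beta0 b0 r r0.
pose M := r `^ beta^-1.
have M0 : 0 < M by exact: powR_gt0.
have rM k : r ^+ k = M `^ (beta * k%:R).
  by rewrite powRrM /M -[(r `^ _) `^ beta]powRrM mulVf ?gt_eqF// powRr1 ?powR_mulrn// ltW.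
pose K := (Num.truncn (beta^-1)).+1.
pose C := M `^ (1 - b) * expR (M + 1).
have C0 : 0 <= C by rewrite mulr_ge0 ?powR_ge0 ?expR_ge0.
exists (C + \sum_(0 <= i < K) `|mlcoef beta b i| * r ^+ i) => k.
have [kK|Kk] := ltnP k K.
  rewrite (bigD1_seq k) ?iota_uniq ?mem_index_iota//=.
  rewrite addrCA lerDl addr_ge0// sumr_ge0// => i _.
  by rewrite mulr_ge0// exprn_ge0// ltW.
apply: (@le_trans _ _ C); last first.
  by rewrite lerDl sumr_ge0// => i _; rewrite mulr_ge0// exprn_ge0// ltW.
have g1 : 1 <= beta * k%:R + b.
  have : beta^-1 <= k%:R by rewrite (le_trans (ltW (truncnS_gt _)))// ler_nat.
  by rewrite -div1r ler_pdivrMr// mulrC => h; rewrite (le_trans h)// lerDl ltW.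
have g0 := lt_le_trans ltr01 g1.
rewrite ger0_norm; last by rewrite ltW// mlcoef_gt0.
rewrite /mlcoef mulrC ler_pdivrMr ?Gamma_gt0// rM.
have := le_Gamma g1 M0.
rewrite -(ler_pM2l (_ : 0 < C)); last by rewrite mulr_gt0 ?powR_gt0 ?expR_gt0.
apply: le_trans; rewrite /C mulrACA -powRD ?(gt_eqF M0) ?implybT// -expRD.
rewrite subrr expR0 mulr1 (_ : 1 - b + _ = beta * k%:R)//; ring.
Qed.

Lemma is_derive_ML beta b x : 0 < beta -> 0 < b ->
  is_derive x (1 : R) (ML beta b) (limn (pseries (pseries_diffs (mlcoef beta b)) x)).
Proof. by move=> h1 h2; apply: entire_is_derive; exact: mlcoef_entire. Qed.

Lemma continuous_ML beta b : 0 < beta -> 0 < b -> continuous (ML beta b).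
Proof.
move=> h1 h2 x; apply: derivable1_cvg.
by case: (is_derive_ML x h1 h2).
Qed.

(** Term by term, [(k + 1) / Gamma(beta k + beta + 1) = 1 / (beta Gamma(beta k + beta))]. *)
Lemma is_derive_ML1 beta x : 0 < beta ->
  is_derive x (1 : R) (ML beta 1) (beta^-1 * ML beta beta x).
Proof.
move=> b0; apply: is_derive_eq (is_derive_ML x b0 ltr01) _.
have -> : pseries_diffs (mlcoef beta 1) = beta^-1 *: mlcoef beta beta.
  apply/funext => k; rewrite /pseries_diffs /mlcoef /GRing.scale/=.
  rewrite -natr1 mulrDr mulr1 GammaS ?mlarg_gt0//.
  have G := @Gamma_gt0 R (beta * k%:R + beta) (mlarg_gt0 k b0 b0).
  have k0 : 0 <= k%:R :> R by [].
  rewrite -[RHS]/(beta^-1 * (Gamma (beta * k%:R + beta))^-1).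
  have e1 : beta * k%:R + beta = beta * (k%:R + 1) by ring.
  rewrite e1 in G *.
  have k1 : 0 < k%:R + 1 :> R by rewrite ltr_wpDl.
  by field; rewrite (gt_eqF G) (gt_eqF b0) (gt_eqF k1).
have -> : pseries (beta^-1 *: mlcoef beta beta) x = beta^-1 *: pseries (mlcoef beta beta) x.
  apply/funext => n; rewrite -[RHS]/(beta^-1 * pseries (mlcoef beta beta) x n).
  by rewrite /pseries /series/= mulr_sumr; apply: eq_bigr => k _; rewrite mulrA.
rewrite limZl_tmp//; exact/entire_cvg/mlcoef_entire.
Qed.

Lemma ML0 beta b : ML beta b 0 = (Gamma b)^-1.
Proof.
apply: cvg_lim => //; rewrite -cvg_shiftS; apply: cvg_near_cst; near=> n.
rewrite /pseries /series/= big_nat_recl//= expr0 mulr1 big1 ?addr0.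
  by rewrite /mlcoef mulr0 add0r.
by move=> i _; rewrite expr0n/= mulr0.
Unshelve. all: by end_near.
Qed.

Lemma ML_shift beta b x : 0 < beta -> 0 < b ->
  ML beta b x = (Gamma b)^-1 + x * ML beta (b + beta) x.
Proof.
move=> h1 h2; have hb : 0 < b + beta by rewrite addr_gt0.
apply: cvg_lim => //; rewrite -cvg_shiftS.
have -> : [sequence pseries (mlcoef beta b) x n.+1]_n =
    (fun n => (Gamma b)^-1 + x * pseries (mlcoef beta (b + beta)) x n).
  apply/funext => n; rewrite /pseries /series/= big_nat_recl//= expr0 mulr1.
  congr (_ + _); first by rewrite /mlcoef mulr0 add0r.
  rewrite mulr_sumr; apply: eq_bigr => i _.
  rewrite exprS mulrCA; congr (_ * (_ * _)).
  by rewrite /mlcoef; congr (Gamma _)^-1; rewrite -natr1; ring.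
apply: cvgD; first exact: cvg_cst.
by apply: cvgMr; exact/entire_cvg/mlcoef_entire.
Qed.

Lemma ML_partial_le beta b x n : 0 < beta -> 0 < b -> 0 <= x ->
  pseries (mlcoef beta b) x n <= ML beta b x.
Proof.
move=> h1 h2 x0; apply: nondecreasing_cvgn_le; last exact/entire_cvg/mlcoef_entire.
apply/nondecreasing_seqP => k; rewrite /pseries /series/= big_nat_recr//= lerDl.
by rewrite mulr_ge0 ?exprn_ge0// ltW// mlcoef_gt0.
Qed.

Lemma ML_le beta b x y : 0 < beta -> 0 < b -> 0 <= x <= y -> ML beta b x <= ML beta b y.
Proof.
move=> h1 h2 /andP[x0 xy]; apply: lim_series_le; try exact/entire_cvg/mlcoef_entire.
move=> n; rewrite ler_wpM2l//; first by rewrite ltW// mlcoef_gt0.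
by rewrite lerXn2r// ?nnegrE// (le_trans x0).
Qed.

End mittag_leffler_series.

(** * Fractional integrals of Mittag-Leffler functions *)

Section Rintegral_sum.
Context d (T : measurableType d) {R : realType} (mu : {measure set T -> \bar R}).

Lemma Rintegral_sum (D : set T) (f : nat -> T -> R) n : measurable D ->
  (forall k, mu.-integrable D (EFin \o f k)) ->
  mu.-integrable D (EFin \o (fun s => \sum_(0 <= k < n) f k s)) /\
  \int[mu]_(s in D) (\sum_(0 <= k < n) f k s) = \sum_(0 <= k < n) \int[mu]_(s in D) f k s.
Proof.
move=> mD fi; elim: n => [|n [IH1 IH2]].
  have E : (fun s => \sum_(0 <= k < 0) f k s) = cst 0 by apply/funext => s; rewrite big_nil.
  rewrite E big_nil; split; first exact: integrable0.
  by rewrite /Rintegral integral0.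
have E : (fun s => \sum_(0 <= k < n.+1) f k s) = (fun s => (\sum_(0 <= k < n) f k s) + f n s).
  by apply/funext => s; rewrite big_nat_recr.
rewrite E; split; first by have := integrableD mD IH1 (fi n).
by rewrite RintegralD// IH2 big_nat_recr.
Qed.

End Rintegral_sum.

Section convolution.
Context {R : realType}.
Local Notation mu := (@lebesgue_measure R).
Implicit Types beta a b lam t : R.

Lemma measurable_beta_integrand D a b t :
  measurable_fun D (fun s : R => (t - s) `^ (a - 1) * s `^ (b - 1)).
Proof.
apply: measurable_funTS; apply: measurable_funM; last exact: measurable_powR.
by apply: (measurableT_comp (measurable_powR _)); exact: measurable_funB.
Qed.

Lemma integrable_beta a b t : 0 < a -> 0 < b -> 0 < t ->
  mu.-integrable `]0, t[ (EFin \o (fun s => (t - s) `^ (a - 1) * s `^ (b - 1))).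
Proof.
move=> a0 b0 t0; apply/integrableP; split.
  by apply/measurable_EFinP; exact: measurable_beta_integrand.
under eq_integral do rewrite /= ger0_norm ?mulr_ge0 ?powR_ge0//.
by rewrite -[X in (X < _)%E]/(betaint a b t) betaintE// ltry.
Qed.

Lemma Rintegral_beta a b t : 0 < a -> 0 < b -> 0 < t ->
  \int[mu]_(s in `]0, t[) ((t - s) `^ (a - 1) * s `^ (b - 1)) =
  t `^ (a + b - 1) * (Gamma a * Gamma b / Gamma (a + b)).
Proof. by move=> a0 b0 t0; rewrite /Rintegral -[X in fine X]/(betaint a b t) betaintE. Qed.

(** Fractional integration acts on the Mittag-Leffler functions by shifting the
    second parameter.  Term by term this is Euler's beta integral; the exchange of
    sum and integral is justified by dominated convergence, as on the bounded
    interval the partial sums are bounded by the value of the series with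
    [|lam|] at the right end point.  It is used with [a = 1 - beta] to compute a
    Caputo derivative and with [a = beta] to obtain a Volterra equation. *)
Lemma ML_convolution beta a b lam t : 0 < beta -> 0 < a -> 0 < b -> 0 < t ->
  let g := fun s => (t - s) `^ (a - 1) * (s `^ (b - 1) * ML beta b (lam * s `^ beta)) in
  mu.-integrable `]0, t[ (EFin \o g) /\
  \int[mu]_(s in `]0, t[) g s =
    Gamma a * (t `^ (a + b - 1) * ML beta (a + b) (lam * t `^ beta)).
Proof.
move=> beta0 a0 b0 t0 g.
have mitv : measurable (`]0, t[%classic : set (measurableTypeR R)) by exact: measurable_itv.
pose c k := mlcoef beta b k * lam ^+ k.
pose T k (s : R) := (t - s) `^ (a - 1) * s `^ (b + beta * k%:R - 1).
have bk k : 0 < b + beta * k%:R by rewrite addrC mlarg_gt0.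
have iT k : mu.-integrable `]0, t[ (EFin \o T k) by exact: integrable_beta.
have icT k : mu.-integrable `]0, t[ (EFin \o (fun s => c k * T k s)).
  by have := integrableZl mitv (c k) (iT k).
pose F n (s : R) := (t - s) `^ (a - 1) * (s `^ (b - 1) * pseries (mlcoef beta b) (lam * s `^
    beta) n).
have FE n : {in `]0, t[%classic, F n =1 (fun s => \sum_(0 <= k < n) c k * T k s)}.
  move=> s; rewrite inE/= in_itv/= => /andP[s0 _].
  rewrite /F /pseries /series/= !mulr_sumr; apply: eq_bigr => k _.
  rewrite /c /T exprMn -(powR_mulrn _ (powR_ge0 s beta)) -powRrM.
  have -> : b + beta * k%:R - 1 = (b - 1) + beta * k%:R by ring.
  by rewrite [s `^ (b - 1 + _)]powRD ?(gt_eqF s0) ?implybT//; ring.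
have intF n : \int[mu]_(s in `]0, t[) F n s =
    Gamma a * (t `^ (a + b - 1) * pseries (mlcoef beta (a + b)) (lam * t `^ beta) n).
  transitivity (\int[mu]_(s in `]0, t[) \sum_(0 <= k < n) c k * T k s).
    by apply: eq_Rintegral; exact: FE.
  have [_ ->] := Rintegral_sum n mitv icT.
  rewrite /pseries /series/= !mulr_sumr; apply: eq_bigr => k _.
  rewrite RintegralZl// Rintegral_beta// /c exprMn -(powR_mulrn _ (powR_ge0 t beta)) -powRrM.
  have -> : a + (b + beta * k%:R) - 1 = (a + b - 1) + beta * k%:R by ring.
  rewrite [t `^ (a + b - 1 + _)]powRD ?(gt_eqF t0) ?implybT// /mlcoef.
  have -> : a + (b + beta * k%:R) = beta * k%:R + (a + b) by ring.
  have -> : b + beta * k%:R = beta * k%:R + b by ring.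
  have G1 := @Gamma_gt0 R _ (mlarg_gt0 k beta0 b0).
  have G2 := @Gamma_gt0 R _ (mlarg_gt0 k beta0 (addr_gt0 a0 b0)).
  by field; rewrite (gt_eqF G1) (gt_eqF G2).
have mF n : measurable_fun `]0, t[ (EFin \o F n).
  have [i1 _] := Rintegral_sum n mitv icT.
  have /integrableP[m1 _] := i1.
  by apply: eq_measurable_fun m1 => s ts; rewrite /= FE.
pose B := ML beta b (`|lam| * t `^ beta).
have ML_cvg x : pseries (mlcoef beta b) x n @[n --> \oo] --> ML beta b x.
  exact/entire_cvg/mlcoef_entire.
have F_g s : (EFin \o F n) s @[n --> \oo] --> (EFin \o g) s.
  apply: cvg_EFin; first by near=> n.
  by apply: cvgMr; apply: cvgMr; exact: ML_cvg.
have mg : measurable_fun `]0, t[ (EFin \o g).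
  by apply: (@emeasurable_fun_cvg _ _ _ _ (fun n => EFin \o F n)).
have domF n s : `]0, t[%classic s -> (`|(EFin \o F n) s| <= (B * ((t - s) `^ (a - 1) * s `^ (b
    - 1)))%:E)%E.
  rewrite /= in_itv/= => /andP[s0 st]; rewrite lee_fin /F mulrA [B * _]mulrC normrM.
  rewrite ger0_norm ?mulr_ge0 ?powR_ge0// ler_wpM2l ?mulr_ge0 ?powR_ge0//.
  have h : `|pseries (mlcoef beta b) (lam * s `^ beta) n| <= pseries (mlcoef beta b) (`|lam| *
      s `^ beta) n.
    rewrite /pseries /series/= (le_trans (ler_norm_sum _ _ _))//.
    apply: ler_sum => k _; rewrite normrM normrX normrM (ger0_norm (powR_ge0 _ _)).
    by rewrite ger0_norm// ltW// mlcoef_gt0.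
  rewrite (le_trans h)// (le_trans (ML_partial_le _ _ _ _))//.
    by rewrite mulr_ge0// powR_ge0.
  apply: ML_le => //; rewrite mulr_ge0 ?powR_ge0//= ler_wpM2l//.
  by apply: ge0_ler_powR; rewrite ?nnegrE ltW.
have iB : mu.-integrable `]0, t[ (EFin \o (fun s => B * ((t - s) `^ (a - 1) * s `^ (b - 1)))).
  by have := integrableZl mitv B (integrable_beta a0 b0 t0).
have aeF : {ae mu, forall s, `]0, t[%classic s -> (EFin \o F n) s @[n --> \oo] --> (EFin \o g)
    s}.
  by apply: aeW => s _; exact: F_g.
have aeB : {ae mu, forall s n, `]0, t[%classic s -> (`|(EFin \o F n) s| <=
    (B * ((t - s) `^ (a - 1) * s `^ (b - 1)))%:E)%E}.
  by apply: aeW => s n; exact: domF.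
have [ig _ lim1] := dominated_convergence mitv mF mg aeF iB aeB.
split=> //.
have lim2 : \int[mu]_(s in `]0, t[) F n s @[n --> \oo] --> \int[mu]_(s in `]0, t[) g s.
  by apply/fine_cvg; rewrite fineK//; exact: integrable_fin_num.
have lim3 : \int[mu]_(s in `]0, t[) F n s @[n --> \oo] -->
   Gamma a * (t `^ (a + b - 1) * ML beta (a + b) (lam * t `^ beta)).
  under eq_fun do rewrite intF.
  by apply: cvgMr; apply: cvgMr; apply/entire_cvg/mlcoef_entire => //; exact: addr_gt0.
by rewrite -(cvg_lim _ lim2)// -(cvg_lim _ lim3).
Unshelve. all: by end_near.
Qed.

End convolution.

(** * The relaxation function *)

Section relaxation.
Context {R : realType}.
Local Notation mu := (@lebesgue_measure R).
Implicit Types beta a b t x : R.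

Lemma caputo_lin beta a b (f g : R -> R) t : caputo_ex beta f t -> caputo_ex beta g t ->
  caputo_ex beta (fun s => a * f s + b * g s) t /\
  caputo beta (fun s => a * f s + b * g s) t = a * caputo beta f t + b * caputo beta g t.
Proof.
have dlin (s : R) : derivable f s 1 -> derivable g s 1 ->
    derivable (fun s => a * f s + b * g s) s 1 /\
    derive1 (fun s => a * f s + b * g s) s = a * derive1 f s + b * derive1 g s.
  move=> df dg; rewrite !derive1E.
  have hf : is_derive s (1 : R) f ('D_1 f s) by apply: DeriveDef.
  have hg : is_derive s (1 : R) g ('D_1 g s) by apply: DeriveDef.
  by have [] := is_deriveD (is_deriveZ a hf) (is_deriveZ b hg).
rewrite /caputo_ex /caputo; case: ifPn => [_ df dg|_ [df jf] [dg jg]].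
  exact: dlin.
have E : {in `]0, t[%classic, (fun s => a * caputo_integrand beta f t s + b * caputo_integrand
    beta g t s)
    =1 caputo_integrand beta (fun s => a * f s + b * g s) t}.
  move=> s; rewrite inE/= in_itv/= => st.
  have [_ h] := dlin s (df s st) (dg s st).
  by rewrite /caputo_integrand h; ring.
have mitv : measurable (`]0, t[%classic : set (measurableTypeR R)) by exact: measurable_itv.
have ja : mu.-integrable `]0, t[ (EFin \o (fun s => a * caputo_integrand beta f t s)).
  by have := integrableZl mitv a jf.
have jb : mu.-integrable `]0, t[ (EFin \o (fun s => b * caputo_integrand beta g t s)).
  by have := integrableZl mitv b jg.
split.
  split; first by move=> s st; have [] := dlin s (df s st) (dg s st).
  have := integrableD mitv ja jb; apply: eq_integrable => //.
  by move=> s ts /=; rewrite -E// EFinD.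
transitivity ((Gamma (1 - beta))^-1 *
    \int[mu]_(s in `]0, t[) (a * caputo_integrand beta f t s + b * caputo_integrand beta g t
        s)).
  by congr (_ * _); apply: eq_Rintegral => s ts; rewrite E.
rewrite RintegralD// RintegralZl// RintegralZl//; ring.
Qed.

(** The solution of the scalar problem with initial value [1] and eigenvalue [x]. *)
Definition relax beta x t : R := ML beta 1 (- (x * t `^ beta)).

Lemma relax0 beta x : 0 < beta -> relax beta x 0 = 1.
Proof. by move=> b0; rewrite /relax powR0 ?gt_eqF// mulr0 oppr0 ML0 Gamma1 invr1. Qed.

Lemma is_derive_relax beta x t : 0 < beta -> 0 < t ->
  is_derive t (1 : R) (relax beta x)
    (- x * (t `^ (beta - 1) * ML beta beta (- x * t `^ beta))).
Proof.
move=> b0 t0.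
have h1 : is_derive t (1 : R) (fun s => - x * s `^ beta) (- x * (beta * t `^ (beta - 1))).
  exact: (is_deriveZ (- x) (is_derive1_powR beta t0)).
have := @is_derive1_comp R (ML beta 1) (fun s => - x * s `^ beta) t _ _ (is_derive_ML1 (- x * t
    `^ beta) b0) h1.
have -> : ML beta 1 \o (fun s => - x * s `^ beta) = relax beta x.
  by apply/funext => s; rewrite /relax/= mulNr.
move=> h; apply: is_derive_eq h _; field; exact: lt0r_neq0.
Qed.

Lemma continuous_relax beta x : 0 < beta -> {within `[0, +oo[, continuous (relax beta x)}.
Proof.
move=> b0; apply/continuous_within_itvcyP; split.
  move=> t; rewrite in_itv/= andbT => t0.
  by apply: derivable1_cvg; have [] := is_derive_relax x b0 t0.
rewrite relax0//.
have -> : 1 = ML beta 1 (- (x * 0)) :> R by rewrite mulr0 oppr0 ML0 Gamma1 invr1.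
apply: (@continuous_cvg _ _ _ (0 : R)^'+ _ (fun t => - (x * t `^ beta)) (ML beta 1)).
  exact: continuous_ML.
by apply: cvgN; apply: cvgMr; exact: powR_cvg0.
Qed.

Lemma relax_caputo beta x t : 0 < beta <= 1 -> 0 < t ->
  caputo_ex beta (relax beta x) t /\ caputo beta (relax beta x) t = - x * relax beta x t.
Proof.
move=> /andP[b0 b1] t0; rewrite /caputo_ex /caputo; case: ifPn => [/eqP E|bN1].
  rewrite E; have [dr der] := is_derive_relax x (@ltr01 R) t0; split => //.
  by rewrite derive1E der subrr powRr0 mul1r /relax !mulNr.
have {}b1 : 0 < 1 - beta by rewrite subr_gt0 lt_neqAle bN1.
have [] := @ML_convolution R beta (1 - beta) beta (- x) t b0 b1 b0 t0.
rewrite (_ : 1 - beta - 1 = - beta); last by ring.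
rewrite (_ : 1 - beta + beta = 1); last by ring.
rewrite subrr powRr0 mul1r.
move=> ig intE.
have mitv : measurable (`]0, t[%classic : set (measurableTypeR R)) by exact: measurable_itv.
have E : {in `]0, t[%classic, (fun s => - x * ((t - s) `^ (- beta) * (s `^ (beta - 1) * ML beta
    beta (- x * s `^ beta))))
   =1 caputo_integrand beta (relax beta x) t}.
  move=> s; rewrite inE/= in_itv/= => /andP[s0 _].
  have [_ h] := is_derive_relax x b0 s0.
  by rewrite /caputo_integrand derive1E h; ring.
split.
  split; first by move=> s /andP[s0 _]; have [] := is_derive_relax x b0 s0.
  have := integrableZl mitv (- x) ig; apply: eq_integrable => //.
  by move=> s ts /=; rewrite -E.
transitivity ((Gamma (1 - beta))^-1 * \int[mu]_(s in `]0, t[)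
    (- x * ((t - s) `^ (- beta) * (s `^ (beta - 1) * ML beta beta (- x * s `^ beta))))).
  by congr (_ * _); apply: eq_Rintegral => s ts; rewrite E.
rewrite RintegralZl// intE /relax -(mulNr x (t `^ beta)).
by field; rewrite gt_eqF// Gamma_gt0.
Qed.

(** Comparison of the opposite function with zero. *)
Lemma relax_ge0 beta x t : 0 < beta <= 1 -> 0 <= x -> 0 <= t -> 0 <= relax beta x t.
Proof.
move=> b01 x0 t0; rewrite -oppr_le0.
have b0 : 0 < beta by case/andP: b01.
have lin s : 0 < s -> _ := fun s0 => caputo_lin (-1) 0 (relax_caputo x b01 s0).1 (relax_caputo
    x b01 s0).1.
have E : (fun s => -1 * relax beta x s + 0 * relax beta x s) = (fun s => - relax beta x s).
  by apply/funext => s; ring.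
rewrite E in lin.
apply: (@caputo_le0 R beta (fun s => - relax beta x s)) => //.
- by move=> s; apply: cvgN; exact: continuous_relax.
- by rewrite relax0// oppr_le0.
- by move=> s s0; have [] := lin s s0.
- move=> s s0 us; have [_ ->] := lin s s0.
  rewrite (relax_caputo x b01 s0).2 mul0r addr0 mulN1r mulNr opprK.
  by rewrite mulr_ge0_le0// ltW// -oppr_gt0.
Qed.

(** The difference [d] of the two functions has Caputo derivative
    [- y d - (y - x) relax beta x], which is nonpositive where [d > 0]: the comparison
    principle applies.  By homogeneity this is monotonicity in time. *)
Lemma relax_le beta x y t : 0 < beta <= 1 -> 0 <= x <= y -> 0 <= t ->
  relax beta y t <= relax beta x t.
Proof.
move=> b01 /andP[x0 xy] t0; rewrite -subr_le0.
have b0 : 0 < beta by case/andP: b01.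
have lin s : 0 < s -> _ := fun s0 => caputo_lin 1 (-1) (relax_caputo y b01 s0).1 (relax_caputo
    x b01 s0).1.
have E : (fun s => 1 * relax beta y s + -1 * relax beta x s) = (fun s =>
    relax beta y s - relax beta x s).
  by apply/funext => s; ring.
rewrite E in lin.
apply: (@caputo_le0 R beta (fun s => relax beta y s - relax beta x s)) => //.
- by move=> s; apply: cvgB; exact: continuous_relax.
- by rewrite !relax0// subrr.
- by move=> s s0; have [] := lin s s0.
- move=> s s0 us; have [_ ->] := lin s s0.
  rewrite (relax_caputo x b01 s0).2 (relax_caputo y b01 s0).2.
  have h0 := relax_ge0 b01 x0 (ltW s0).
  have h1 : 0 <= y * (relax beta y s - relax beta x s) by apply: mulr_ge0;
      [exact: le_trans xy|exact: ltW].
  have h2 : 0 <= (y - x) * relax beta x s by rewrite mulr_ge0// subr_ge0.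
  lra.
Qed.

Lemma relax_le1 beta x t : 0 < beta <= 1 -> 0 <= x -> 0 <= t -> relax beta x t <= 1.
Proof.
move=> b01 x0 t0; have := relax_le b01 (_ : 0 <= 0 <= x) t0.
by rewrite lexx x0 {2}/relax mul0r oppr0 ML0 Gamma1 invr1; exact.
Qed.

(** Self-similarity: the time dependence can be moved into the eigenvalue. *)
Lemma relaxE1 beta x t : relax beta x t = relax beta (x * t `^ beta) 1.
Proof. by rewrite /relax powR1 mulr1. Qed.

Lemma relax_itv beta x t : 0 < beta <= 1 -> 0 <= x -> 0 <= relax beta x t <= 1.
Proof.
move=> b01 x0; have xt : 0 <= x * t `^ beta by rewrite mulr_ge0// powR_ge0.
by rewrite relaxE1 relax_ge0//= relax_le1.
Qed.

(** With [e] the value at time [1], the Volterra equation reads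
    [e = 1 - y / Gamma(beta) * I], with [I] the integral of [(1 - s) ^ (beta - 1)] times
    the solution at time [s].  The solution being nonincreasing, [I >= e / beta],
    whence [y e <= Gamma(beta + 1) (1 - e)]. *)
Lemma relax_decay beta x t : 0 < beta <= 1 -> 0 <= x ->
  (1 + x * t `^ beta) * relax beta x t <= 1 + Gamma (beta + 1).
Proof.
move=> b01; have b0 : 0 < beta by case/andP: b01.
suff H y : 0 <= y -> (1 + y) * relax beta y 1 <= 1 + Gamma (beta + 1).
  by move=> x0; rewrite relaxE1; apply: H; rewrite mulr_ge0// powR_ge0.
move=> y0; set e := relax beta y 1.
have e1 : e <= 1 by exact: relax_le1.
have [ig intE] := @ML_convolution R beta beta 1 (- y) 1 b0 b0 ltr01 ltr01.
have mitv : measurable (`]0%R, 1%R[%classic : set (measurableTypeR R)) by exact: measurable_itv.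
have ibeta : mu.-integrable `]0, 1[ (EFin \o (fun s : R =>
    (1 - s) `^ (beta - 1) * s `^ (1 - 1))).
  by apply: integrable_beta.
have e0 : 0 <= e by exact: relax_ge0.
(* e = 1 - y m, with Gamma(beta) m the integral in the Volterra equation. *)
pose m := ML beta (beta + 1) (- y).
have em : e <= Gamma (beta + 1) * m.
  have : \int[mu]_(s in `]0, 1[) (e * ((1 - s) `^ (beta - 1) * s `^ (1 - 1))) <=
      Gamma beta * (1 `^ (beta + 1 - 1) * ML beta (beta + 1) (- y * 1 `^ beta)).
    rewrite -intE; apply: le_Rintegral => //.
      by have := integrableZl mitv e ibeta.
    move=> s; rewrite /= in_itv/= => /andP[s0 s1].
    rewrite subrr powRr0 mulr1 mul1r mulrC ler_wpM2l ?powR_ge0//.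
    have -> : ML beta 1 (- y * s `^ beta) = relax beta (y * s `^ beta) 1.
      by rewrite -relaxE1 /relax mulNr.
    apply: relax_le => //; rewrite mulr_ge0 ?powR_ge0//= ler_piMr//.
    suff : s `^ beta <= 1 `^ beta by rewrite powR1.
    by apply: ge0_ler_powR; rewrite ?nnegrE ?ltW.
  rewrite RintegralZl// Rintegral_beta// !powR1 !mul1r mulr1 Gamma1 mulr1 -/m GammaS//.
  have G := @Gamma_gt0 R beta b0.
  have -> : Gamma beta / (beta * Gamma beta) = beta^-1 by field; rewrite (gt_eqF G) gt_eqF.
  by rewrite ler_pdivrMr// => h; rewrite -mulrA [beta * _]mulrC.
have G1 : 0 < Gamma (beta + 1) :> R by rewrite Gamma_gt0// addr_gt0.
have eE : e = 1 - y * m.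
  rewrite /e /relax powR1 mulr1 ML_shift// Gamma1 invr1 mulNr.
  by rewrite [1 + beta]addrC.
have h1 : y * e <= Gamma (beta + 1) * (y * m) by rewrite mulrCA ler_wpM2l.
have h2 : 0 <= Gamma (beta + 1) * e by rewrite mulr_ge0// ltW.
have h3 : Gamma (beta + 1) * (y * m) = Gamma (beta + 1) - Gamma (beta + 1) * e.
  by rewrite eE; ring.
rewrite mulrDl mul1r; lra.
Qed.

End relaxation.

(** * The scalar problem *)

Section scalar_problem.
Context {R : realType}.
Implicit Types beta t x : R.

Lemma normc_realE x : `|x%:C| = `|x|%:C :> R[i].
Proof. by rewrite normc_def/= expr0n/= addr0 sqrtr_sqr. Qed.

Lemma gt0_realC (z : R[i]) : 0 < z -> 0 < complex.Re z /\ z = (complex.Re z)%:C.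
Proof.
rewrite ltcE/= => /andP[/eqP i0 r0]; split => //.
by case: z i0 r0 => a b /= ->.
Qed.

Lemma mittag_leffler_real beta x : 0 < beta ->
  mittag_leffler beta x%:C = (ML beta 1 x)%:C.
Proof.
move=> b0; apply: (@cvg_lim R[i]^o); first exact: norm_hausdorff.
have ML_cvg : pseries (mlcoef beta 1) x n @[n --> \oo] --> ML beta 1 x.
  exact/entire_cvg/mlcoef_entire.
apply/cvgrPdist_lt => eps eps0.
have [e0 epsE] := gt0_realC eps0.
move/cvgrPdist_lt : ML_cvg => /(_ _ e0); apply: filterS => n h.
rewrite epsE.
have -> : series (fun k => x%:C ^+ k / (Gamma (beta * k%:R + 1))%:C : R[i]^o) n
    = (pseries (mlcoef beta 1) x n)%:C.
  rewrite /pseries /series/= rmorph_sum/=; apply: eq_bigr => k _.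
  by rewrite /mlcoef rmorphM rmorphXn/= fmorphV mulrC.
by rewrite -rmorphB normc_realE ltcR.
Qed.

(** The comparison principle applied to the difference of two solutions and to
    its opposite. *)
Lemma caputo_unique beta x (f g : R -> R) : 0 < beta <= 1 -> 0 <= x ->
  {within `[0, +oo[, continuous f} -> {within `[0, +oo[, continuous g} -> f 0 = g 0 ->
  (forall t, 0 < t -> caputo_ex beta f t /\ caputo beta f t = - x * f t) ->
  (forall t, 0 < t -> caputo_ex beta g t /\ caputo beta g t = - x * g t) ->
  forall t, 0 <= t -> f t = g t.
Proof.
move=> b01 x0.
suff H (f1 f2 : R -> R) : {within `[0, +oo[, continuous f1} -> {within `[0, +oo[,
    continuous f2} -> f1 0 = f2 0 ->
  (forall t, 0 < t -> caputo_ex beta f1 t /\ caputo beta f1 t = - x * f1 t) ->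
  (forall t, 0 < t -> caputo_ex beta f2 t /\ caputo beta f2 t = - x * f2 t) ->
  forall t, 0 <= t -> f1 t - f2 t <= 0.
  move=> cf cg fg0 Hf Hg t t0; apply/eqP; rewrite eq_le -subr_le0 H//=.
  by rewrite -subr_le0 H.
move=> c1 c2 f0 H1 H2; apply: (@caputo_le0 R beta (fun s => f1 s - f2 s) b01).
- by move=> s; apply: cvgB; [exact: c1|exact: c2].
- by rewrite f0 subrr.
- move=> s s0; have := (caputo_lin 1 (-1) (H1 s s0).1 (H2 s s0).1).1.
  by congr caputo_ex; apply/funext => ?; ring.
- move=> s s0 fs; have := (caputo_lin 1 (-1) (H1 s s0).1 (H2 s s0).1).2.
  have -> : (fun s => 1 * f1 s + -1 * f2 s) = (fun s => f1 s - f2 s) by apply/funext => ?; ring.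
  move=> ->; rewrite (H1 s s0).2 (H2 s s0).2.
  have -> : 1 * (- x * f1 s) + -1 * (- x * f2 s) = - (x * (f1 s - f2 s)) by ring.
  by rewrite oppr_le0 mulr_ge0// ltW.
Qed.

Lemma scalar_solution_relax beta x (c : R[i]) : 0 < beta <= 1 ->
  scalar_solution beta x c (fun t => c * (relax beta x t)%:C).
Proof.
move=> b01; have b0 : 0 < beta by case/andP: b01.
case: c => a b.
have ReE : (fun s => complex.Re ((a +i* b) * (relax beta x s)%:C)) = (fun s =>
    a * relax beta x s + 0 * relax beta x s).
  by apply/funext => s; rewrite /= mulr0 subr0; ring.
have ImE : (fun s => complex.Im ((a +i* b) * (relax beta x s)%:C)) = (fun s =>
    b * relax beta x s + 0 * relax beta x s).
  by apply/funext => s; rewrite /=; ring.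
split; last by rewrite relax0// mulr1.
move=> t t0; rewrite /caputoC_ex /caputoC ReE ImE.
have [ex eqE] := relax_caputo x b01 t0.
have [h1 h2] := caputo_lin a 0 ex ex; have [h3 h4] := caputo_lin b 0 ex ex.
split => //; rewrite h2 h4 eqE; simpc; apply/eqP; rewrite eq_complex/=.
by apply/andP; split; apply/eqP; ring.
Qed.

Lemma scalar_solutionP beta x c (f : R -> R[i]) : scalar_solution beta x c f ->
  f 0 = c /\ forall t, 0 < t ->
  [/\ caputo_ex beta (fun s => complex.Re (f s)) t,
      caputo beta (fun s => complex.Re (f s)) t = - x * complex.Re (f t),
      caputo_ex beta (fun s => complex.Im (f s)) t &
      caputo beta (fun s => complex.Im (f s)) t = - x * complex.Im (f t)].
Proof.
move=> [H f0]; split => // t /H [[exr exi]] /eqP.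
rewrite /caputoC; case: (f t) => a b; simpc; rewrite eq_complex/= => /andP[/eqP h1 /eqP h2].
split => //; apply/eqP; rewrite /= ?mulNr -addr_eq0; apply/eqP; first by rewrite -[RHS]h1; ring.
by rewrite -[RHS]h2; ring.
Qed.

Lemma scalar_solution_unique beta x c (f g : R -> R[i]) : 0 < beta <= 1 -> 0 <= x ->
  {within `[0, +oo[, continuous (fun s => complex.Re (f s))} ->
  {within `[0, +oo[, continuous (fun s => complex.Im (f s))} ->
  {within `[0, +oo[, continuous (fun s => complex.Re (g s))} ->
  {within `[0, +oo[, continuous (fun s => complex.Im (g s))} ->
  scalar_solution beta x c f -> scalar_solution beta x c g ->
  forall t, 0 <= t -> f t = g t.
Proof.
move=> b01 x0 c1 c2 c3 c4 /scalar_solutionP[f0 Hf] /scalar_solutionP[g0 Hg] t t0.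
apply/eqP; rewrite eq_complex; apply/andP; split; apply/eqP.
- apply: (caputo_unique b01 x0 c1 c3 _ _ _ t0); first by rewrite f0 g0.
    by move=> s /Hf[].
  by move=> s /Hg[].
- apply: (caputo_unique b01 x0 c2 c4 _ _ _ t0); first by rewrite f0 g0.
    by move=> s /Hf[].
  by move=> s /Hg[].
Qed.

End scalar_problem.

(** * Multipliers on an orthonormal basis *)

Section hilbert.
Context {R : realType} {H : completeNormedModType R[i]}.
Context (ip : {dot H for Num.conj}) {I : countType} (e : I -> H).
Hypothesis hilbert_norm : forall x : H, `|x| ^+ 2 = ip x x.
Hypothesis e_basis : orthonormal_basis ip e.

Local Notation fourier := (fourier ip e).
Local Notation combination s c := (\sum_(i <- s) (c i : R[i]) *: e i).

Lemma ip_combination (s : seq I) (c : I -> R[i]) j : uniq s ->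
  ip (combination s c) (e j) = if j \in s then c j else 0.
Proof.
have [oe _] := e_basis.
elim: s => [|i s IH] /=; first by rewrite big_nil linear0l.
move=> /andP[is_ us]; rewrite big_cons linearDl linearZl_LR/= IH// oe inE eq_sym.
have [->|ij] := eqVneq j i; first by rewrite mulr1 (negbTE is_) addr0.
by rewrite mulr0 add0r.
Qed.

Lemma ip_combinationr (x : H) (s : seq I) (c : I -> R[i]) :
  ip x (combination s c) = \sum_(i <- s) Num.conj (c i) * fourier x i.
Proof. by rewrite linear_sumr; apply: eq_bigr => i _; rewrite linearZr_LR. Qed.

Lemma norm_combination (s : seq I) (c : I -> R[i]) : uniq s ->
  `|combination s c| ^+ 2 = \sum_(i <- s) `|c i| ^+ 2.
Proof.
move=> us; rewrite hilbert_norm ip_combinationr [LHS]big_seq [RHS]big_seq.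
apply: eq_bigr => i si; rewrite /Defs.fourier ip_combination// si mulrC.
by rewrite normCK.
Qed.

Lemma fourierB x y i : fourier (x - y) i = fourier x i - fourier y i.
Proof. exact: linearBl. Qed.

Lemma norm_sub_combination x (s : seq I) : uniq s ->
  `|x - combination s (fourier x)| ^+ 2 = `|x| ^+ 2 - \sum_(i <- s) `|fourier x i| ^+ 2.
Proof.
move=> us; rewrite [LHS]hilbert_norm dnormB/= -!hilbert_norm norm_combination//.
have -> : ip x (combination s (fourier x)) = \sum_(i <- s) `|fourier x i| ^+ 2.
  by rewrite ip_combinationr; apply: eq_bigr => i _; rewrite normCK mulrC.
have -> : Num.conj (\sum_(i <- s) `|fourier x i| ^+ 2) = \sum_(i <- s) `|fourier x i| ^+ 2.
  rewrite rmorph_sum/=; apply: eq_bigr => i _; rewrite rmorphXn/=.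
  by congr (_ ^+ 2); apply/CrealP; exact: normr_real.
by rewrite opprD addrA addrK.
Qed.

Lemma bessel x (s : seq I) : uniq s -> \sum_(i <- s) `|fourier x i| ^+ 2 <= `|x| ^+ 2.
Proof. by move=> us; rewrite -subr_ge0 -norm_sub_combination// exprn_ge0. Qed.

Lemma norm_fourier_le x i : `|fourier x i| <= `|x|.
Proof.
have := @bessel x [:: i] isT; rewrite big_seq1.
by rewrite ler_pXn2r// ?nnegrE.
Qed.

(** A vector [z] orthogonal to all [e i] is orthogonal to their span, so no
    element of the span is closer to [z] than [0] is; the span being dense, [z = 0]. *)
Lemma fourier_inj x y : fourier x =1 fourier y -> x = y.
Proof.
move=> xy; apply/eqP; rewrite -subr_eq0; set z := x - y.
have z0 i : ip z (e i) = 0 by rewrite -[LHS]/(fourier z i) fourierB xy subrr.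
apply/negPn/negP => zN0; have nz : 0 < `|z| by rewrite normr_gt0.
have [_ /(_ (ball z `|z|))] := e_basis.
move=> [||p [/= zp [s [c pE]]]].
- by exists z; exact: ballxx.
- exact: ball_open.
have zp0 : ip z p = 0.
  rewrite pE ip_combinationr big1// => i _.
  by rewrite /Defs.fourier z0 mulr0.
move: zp; rewrite -ball_normE/= -(@ltr_pXn2r _ 2)// ?nnegrE//.
rewrite [ltLHS]hilbert_norm dnormB/= zp0 conjC0 addr0 subr0 -!hilbert_norm -subr_gt0 opprD
    addNKr oppr_gt0.
by apply/negP; rewrite -real_leNgt ?exprn_ge0 ?real0// ger0_real// exprn_ge0.
Qed.

Lemma normC_normc (z : R[i]) : `|z| = (Normc.normc z)%:C.
Proof. by case: z. Qed.

(** The finite sums of [|fourier x i| ^ 2] are bounded by Bessel's inequality.  Once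
    one of them is close to the supremum, the terms outside contribute little, so
    the net of partial sums satisfies the Cauchy criterion. *)
Lemma multiplier_cvg x (m : I -> R[i]) (M : R) : 0 <= M -> (forall i, `|m i| <= M%:C) ->
  exists g : H, partial_sum (fun i => (m i * fourier x i) *: e i) @ totally --> g.
Proof.
move=> M0 mM; apply/cvg_ex; apply/cauchy_cvgP.
apply: cauchy_exP => eps eps0.
pose q (A : {fset I}) : R := \sum_(i <- A) Normc.normc (fourier x i) ^+ 2.
have qE (A : {fset I}) : (q A)%:C = \sum_(i <- A) `|fourier x i| ^+ 2.
  by rewrite rmorph_sum/=; apply: eq_bigr => i _; rewrite normC_normc rmorphXn.
have qub : has_sup (range q).
  split; first by exists (q fset0), fset0.
  exists (Normc.normc (`|x|) ^+ 2) => _ [A _ <-].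
  rewrite -lecR qE rmorphXn/= -normC_normc normr_id; apply: bessel; exact: fset_uniq.
have [e0 epsE] := gt0_realC eps0.
set e1 := complex.Re eps in e0 epsE.
(* M + 1 instead of M keeps the denominator positive. *)
pose d := (e1 / (M + 1)) ^+ 2.
have M1 : 0 < M + 1 by rewrite ltr_wpDl.
have d0 : 0 < d by rewrite exprn_gt0// divr_gt0.
have [_ [A _ <-] supA] := sup_adherent d0 qub.
exists (partial_sum (fun i => (m i * fourier x i) *: e i) A), A => // B /= AB.
rewrite -ball_normE/=.
have pE (D : {fset I}) : partial_sum (fun i => (m i * fourier x i) *: e i) D =
    combination D (fun i => m i * fourier x i).
  by rewrite big_seq_fsetE.
have split_sum (V : nmodType) (F : I -> V) :
    \sum_(i <- B) F i = \sum_(i <- A) F i + \sum_(i <- (B `\` A)%fset) F i.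
  rewrite (big_fsetID _ (mem A)); congr (_ + _); apply: eq_fbigl => i; rewrite !inE/=.
    by rewrite andb_idl// => /(fsubsetP AB).
  by rewrite andbC.
rewrite !pE distrC split_sum addrAC subrr add0r.
rewrite -(@ltr_pXn2r _ 2)// ?nnegrE ?(ltW eps0)// norm_combination ?fset_uniq//.
have qBA : q (B `\` A)%fset < d.
  have : q B <= sup (range q) by apply: sup_upper_bound => //; exists B.
  by rewrite /q split_sum -/(q A) -/(q (B `\` A)%fset); lra.
apply: (@le_lt_trans _ _ ((M ^+ 2 * q (B `\` A)%fset)%:C)).
  rewrite rmorphM/= qE rmorphXn/= mulr_sumr; apply: ler_sum => i _.
  by rewrite normrM exprMn ler_wpM2r ?exprn_ge0// lerXn2r ?nnegrE// lecR.
rewrite epsE -rmorphXn/= ltcR.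
apply: (@le_lt_trans _ _ ((M + 1) ^+ 2 * q (B `\` A)%fset)).
  rewrite ler_wpM2r//; first by rewrite sumr_ge0// => i _; exact: sqr_ge0.
  by rewrite lerXn2r ?nnegrE ?(ltW M1)// lerDl.
rewrite -ltr_pdivlMl ?exprn_gt0//; apply: lt_le_trans qBA _.
by rewrite /d expr_div_n mulrC.
Qed.

Lemma continuous_fourier i : continuous (fun x : H => fourier x i : R[i]^o).
Proof.
move=> x; apply/cvgrPdist_lt => eps eps0.
have : \forall y \near x, ball x eps y by exact: nbhsx_ballx.
apply: filterS => y; rewrite -ball_normE/= => xy.
by apply: le_lt_trans xy; rewrite -fourierB norm_fourier_le.
Qed.

Lemma fourier_limit x (m : I -> R[i]) g :
  partial_sum (fun i => (m i * fourier x i) *: e i) @ totally --> g ->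
  forall j, fourier g j = m j * fourier x j.
Proof.
move=> cg j.
have h1 : (fun A => fourier (partial_sum (fun i => (m i * fourier x i) *: e i) A) j :
    R[i]^o) @ totally
    --> (fourier g j : R[i]^o).
  exact: (@cvg_comp _ _ _ _ (fun y => fourier y j : R[i]^o) _ _ _ cg (@continuous_fourier j g)).
have h2 : (fun A => fourier (partial_sum (fun i => (m i * fourier x i) *: e i) A) j :
    R[i]^o) @ totally
    --> (m j * fourier x j : R[i]^o).
  apply: cvg_near_cst; exists [fset j]%fset => // A /= jA.
  rewrite /Defs.fourier /partial_sum -(big_seq_fsetE _ A xpredT (fun i =>
      (m i * fourier x i) *: e i)).
  rewrite ip_combination ?fset_uniq//.
  by rewrite (fsubsetP jA) ?inE.
exact: (@cvg_unique _ (@norm_hausdorff _ R[i]^o) _ _ _ _ h1 h2).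
Qed.

(** The bound holds for the partial sums by Bessel's inequality, and passes to
    their limit, which is [g] because it has the same coefficients. *)
Lemma multiplier_norm x g (m : I -> R[i]) (M : R) : 0 <= M -> (forall i, `|m i| <= M%:C) ->
  (forall i, fourier g i = m i * fourier x i) -> `|g| <= M%:C * `|x|.
Proof.
move=> M0 mM gE.
have MC0 : 0 <= M%:C :> R[i] by rewrite lecR.
have [g' cg'] := multiplier_cvg x M0 mM.
have -> : g = g' by apply: fourier_inj => i; rewrite gE (fourier_limit cg').
have real_norm (z : H) : `|z| = (Normc.normc `|z|)%:C by rewrite -normC_normc normr_id.
have normM : M%:C * `|x| = (M * Normc.normc `|x|)%:C by rewrite rmorphM/= -real_norm.
rewrite normM (real_norm g') lecR; apply/ler_addgt0Pr => eps eps0; rewrite -lecR -real_norm.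
have epsC : 0 < eps%:C :> R[i] by rewrite ltcR.
have [A _ hA] := (@cvgrPdist_lt _ _ _ _ _ _ _).1 cg' _ epsC.
have := hA A; rewrite /= fsubset_refl => /(_ isT).
set p := partial_sum _ A => gp.
rewrite -(subrK p g') (le_trans (ler_normD _ _))// addrC rmorphD/= lerD//; last exact: ltW.
rewrite rmorphM/= -real_norm -(@ler_pXn2r _ 2)// ?nnegrE ?mulr_ge0//.
rewrite /p /partial_sum -(big_seq_fsetE _ A xpredT (fun i => (m i * fourier x i) *: e i)).
rewrite norm_combination ?fset_uniq//.
apply: (@le_trans _ _ (M%:C ^+ 2 * \sum_(i <- A) `|fourier x i| ^+ 2)).
  rewrite mulr_sumr; apply: ler_sum => i _.
  by rewrite normrM exprMn ler_wpM2r ?exprn_ge0// lerXn2r ?nnegrE.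
by rewrite exprMn ler_wpM2l ?exprn_ge0// bessel ?fset_uniq.
Qed.

End hilbert.

(** * Sobolev norms and the heat flow *)

Section sobolev_norms.
Context {R : realType} {I : countType} (gamma : I -> R).
Hypothesis gamma_ge0 : forall i, 0 <= gamma i.

Lemma esumZ_le (K : R) (a : I -> \bar R) : 0 <= K -> (forall i, (0 <= a i)%E) ->
  (\esum_(i in [set: I]) (K%:E * a i) <= K%:E * \esum_(i in [set: I]) a i)%E.
Proof.
move=> K0 a0; apply: ge_ereal_sup => _ [A fA <-].
rewrite -ge0_mule_fsumr//; apply: lee_wpmul2l; first by rewrite lee_fin.
by apply: esum_ge; exists A.
Qed.

(** The norms are weighted sums of squares, so that a bound on the multiplier
    relative to the weights bounds the ratio of the norms.  The constant may be
    taken out of the sum as an inequality, which covers divergent sums. *)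
Lemma sobolev_norm_le (d1 d2 K : R) (m : I -> R) (c1 c2 : I -> R[i]) : 0 <= K ->
  (forall i, c1 i = (m i)%:C * c2 i) ->
  (forall i, `|(1 + gamma i) `^ (d1 / 2) * m i| <= K * (1 + gamma i) `^ (d2 / 2)) ->
  (sobolev_norm gamma d1 c1 <= K%:E * sobolev_norm gamma d2 c2)%E.
Proof.
move=> K0 cE mK.
have term0 d (c : I -> R[i]) i : (0 <= ((1 + gamma i) `^ d * Normc.normc (c i) ^+ 2)%:E)%E.
  by rewrite lee_fin mulr_ge0 ?powR_ge0 ?sqr_ge0.
set S2 := (\esum_(i in [set: I]) ((1 + gamma i) `^ d2 * Normc.normc (c2 i) ^+ 2)%:E)%E.
have S20 : (0 <= S2)%E by apply: esum_ge0 => i _.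
have -> : (K%:E * sobolev_norm gamma d2 c2 = poweR ((K ^+ 2)%:E * S2) 2^-1)%E.
  rewrite poweRM ?lee_fin ?sqr_ge0// poweR_EFin powR12_sqrt ?sqr_ge0//.
  by rewrite sqrtr_sqr ger0_norm.
have S10 : (0 <= \esum_(i in [set: I]) ((1 + gamma i) `^ d1 * Normc.normc (c1 i) ^+ 2)%:E)%E.
  by apply: esum_ge0 => i _.
apply: gt0_ler_poweR => //; rewrite ?in_itv/= ?leey ?andbT// ?mule_ge0 ?lee_fin ?sqr_ge0//.
apply: le_trans (esumZ_le _ _); rewrite ?sqr_ge0//.
apply: le_esum => i _; rewrite -EFinM lee_fin cE Normc.normcM.
have -> : Normc.normc (m i)%:C = `|m i| by rewrite /= expr0n/= addr0 sqrtr_sqr.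
have g0 : 0 < 1 + gamma i by rewrite ltr_pwDl.
have powE d : (1 + gamma i) `^ d = ((1 + gamma i) `^ (d / 2)) ^+ 2.
  by rewrite -powR_mulrn ?powR_ge0// -powRrM divfK// pnatr_eq0.
rewrite (powE d1) (powE d2) exprMn [leLHS]mulrA [leRHS]mulrA ler_wpM2r ?sqr_ge0// -!exprMn.
rewrite -real_normK ?num_real// normrM normr_id -normrM.
by rewrite lerXn2r ?nnegrE// ?mulr_ge0 ?powR_ge0.
Qed.

End sobolev_norms.

Section heat_flow.
Context {R : realType} {H : completeNormedModType R[i]}.
Context (ip : {dot H for Num.conj}) {I : countType} (gamma : I -> R) (e : I -> H).
Context (beta : R).
Hypothesis hilbert_norm : forall x : H, `|x| ^+ 2 = ip x x.
Hypothesis e_basis : orthonormal_basis ip e.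
Hypothesis gamma_ge0 : forall i, 0 <= gamma i.
Hypothesis beta01 : 0 < beta <= 1.

Local Notation fourier := (fourier ip e).

Lemma exists_multiplier (x : H) (m : I -> R) (M : R) : (forall i, `|m i| <= M) ->
  exists g : H, forall i, fourier g i = (m i)%:C * fourier x i.
Proof.
move=> mM; have [Mneg|M0] := ltP M 0.
  exists 0 => i; have := mM i; rewrite leNgt.
  by rewrite (lt_le_trans Mneg).
have mM' i : `|(m i)%:C| <= M%:C by rewrite normc_realE lecR.
have [g cg] := multiplier_cvg hilbert_norm e_basis x M0 mM'.
exists g; exact: fourier_limit cg.
Qed.

(** A finite combination [p] of the [e i] approximates [w0].  The part of
    [w t0 - w t] that comes from [p] is a finite sum of continuous functions; the
    rest has norm at most [2 |w0 - p|], uniformly in [t]. *)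
Lemma multiplier_continuous (u : I -> R -> R) (w0 : H) (w : R -> H) :
  (forall i t, `|u i t| <= 1) ->
  (forall i, {within `[0, +oo[, continuous (u i)}) ->
  (forall t i, fourier (w t) i = (u i t)%:C * fourier w0 i) ->
  {within `[0, +oo[, continuous w}.
Proof.
move=> u1 cu wE; apply/subspace_continuousP => t0 t00.
apply/cvgrPdist_lt => eps eps0.
have [e0 epsE] := gt0_realC eps0.
set e1 := complex.Re eps in e0 epsE.
(* The multiplier 1 gives the expansion of w0 in the basis. *)
have id1 (i : I) : `|(fun=> 1 : R[i]) i| <= (1 : R)%:C by rewrite normr1.
have [g cg] := multiplier_cvg hilbert_norm e_basis w0 ler01 id1.
have gE : g = w0.
  apply: (fourier_inj hilbert_norm e_basis) => i.
  by rewrite (fourier_limit hilbert_norm e_basis cg) mul1r.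
have e40 : 0 < (e1 / 4)%:C :> R[i] by rewrite ltcR divr_gt0.
have [A _ hA] := (@cvgrPdist_lt _ _ _ _ _ _ _).1 cg _ e40.
have := hA A; rewrite /= fsubset_refl gE => /(_ isT).
set p := partial_sum _ A => w0p.
pose z t := \sum_(i <- A) ((u i t0 - u i t)%:C * fourier w0 i) *: e i.
have zcvg : z t @[t --> within `[0, +oo[ (nbhs t0)] --> (0 : H).
  have -> : 0 = \sum_(i <- A) (((0 : R)%:C * fourier w0 i) *: e i) :> H.
    by rewrite big1// => i _; rewrite mul0r scale0r.
  rewrite /z; elim: (enum_fset A) => [|i s IH].
    by under eq_fun do rewrite big_nil; rewrite big_nil; exact: cvg_cst.
  under eq_fun do rewrite big_cons; rewrite big_cons; apply: cvgD => //.
  apply/cvgrPdist_lt => d d0.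
  have [d1 dE] := gt0_realC d0.
  have ci : u i t @[t --> within `[0, +oo[ (nbhs t0)] --> u i t0.
    exact: (subspace_continuousP _ _).1 (cu i) t0 t00.
  pose K := Normc.normc `|fourier w0 i *: e i| + 1.
  have K0 : 0 < K by rewrite ltr_wpDl// /K; case: (`|fourier w0 i *: e i|) => a b;
      exact: sqrtr_ge0.
  have dK : 0 < complex.Re d / K by rewrite divr_gt0.
  move/cvgrPdist_lt : ci => /(_ _ dK); apply: filterS => t ht.
  rewrite mul0r scale0r sub0r normrN -scalerA normrZ normc_realE.
  have -> : `|fourier w0 i *: e i| = (Normc.normc `|fourier w0 i *: e i|)%:C.
    by rewrite -normC_normc normr_id.
  rewrite -rmorphM/= dE ltcR.
  apply: (@le_lt_trans _ _ (`|u i t0 - u i t| * K)); first by rewrite ler_wpM2l// lerDl.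
  by rewrite -ltr_pdivlMr.
have e20 : 0 < (e1 / 2)%:C :> R[i] by rewrite ltcR divr_gt0.
move/cvgrPdist_lt : zcvg => /(_ _ e20); apply: filterS => t; rewrite sub0r normrN => zt.
rewrite -(subrK (z t) (w t0 - w t)) (le_lt_trans (ler_normD _ _))//.
have -> : eps = (e1 / 2)%:C + (e1 / 2)%:C by rewrite -rmorphD/= -splitr.
rewrite ler_ltD//.
have zE i : fourier (z t) i = if i \in A then (u i t0 - u i t)%:C * fourier w0 i else 0.
  by rewrite /z /Defs.fourier (ip_combination e_basis (fun i =>
      (u i t0 - u i t)%:C * fourier w0 i)) ?fset_uniq.
have pE i : fourier p i = if i \in A then fourier w0 i else 0.
  rewrite /p /partial_sum -(big_seq_fsetE _ A xpredT (fun i => (1 * fourier w0 i) *: e i)).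
  by rewrite /Defs.fourier (ip_combination e_basis) ?fset_uniq// mul1r.
have m2 i : `|(u i t0 - u i t)%:C| <= 2%:C.
  rewrite normc_realE lecR (le_trans (ler_normB _ _))//.
  by rewrite -[leRHS]/(1 + 1) lerD.
have := @multiplier_norm _ _ _ _ _ hilbert_norm e_basis (w0 - p) (w t0 - w t - z t) (fun i =>
    (u i t0 - u i t)%:C) 2 _ m2 _.
move=> /(_ _ _); rewrite ler0n => /(_ isT) h.
apply: le_trans (h _) _.
  move=> i; rewrite !fourierB !wE zE pE; case: ifP => _;
      rewrite ?subrr ?mulr0 ?subr0 rmorphB/= -mulrBl ?subrr//.
apply: (@le_trans _ _ (2%:C * (e1 / 4)%:C)).
  by rewrite ler_wpM2l ?lecR// ltW.
have -> : e1 / 2 = 2 * (e1 / 4) by field.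
by rewrite -rmorphM/= lecR.
Qed.

Lemma Im_norm_le (z : R[i]) : `|complex.Im z|%:C <= `|z|.
Proof.
case: z => a b; rewrite normc_def/= lecR -sqrtr_sqr ler_wsqrtr// lerDr sqr_ge0//.
Qed.

Lemma continuous_coordinate (phi : R[i] -> R) (v : R -> H) i :
  (forall a b, phi (a - b) = phi a - phi b) -> (forall a, `|phi a|%:C <= `|a|) ->
  {within `[0, +oo[, continuous v} ->
  {within `[0, +oo[, continuous (fun t => phi (fourier (v t) i))}.
Proof.
move=> phiB phi_le /subspace_continuousP cv; apply/subspace_continuousP => t t0.
apply/cvgrPdist_lt => eps eps0.
have epsC : 0 < eps%:C :> R[i] by rewrite ltcR.
move: (cv t t0) => /cvgrPdist_lt/(_ _ epsC); apply: filterS => s vs.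
rewrite -phiB -fourierB -ltcR (le_lt_trans (phi_le _))//.
exact: le_lt_trans (norm_fourier_le hilbert_norm e_basis _ _) vs.
Qed.

Lemma heat_solution_exists (w0 : H) : exists w : R -> H,
  [/\ forall t i, fourier (w t) i = (relax beta (gamma i) t)%:C * fourier w0 i,
      {within `[0, +oo[, continuous w},
      heat_solution ip gamma e beta w0 w &
      given_by_series ip gamma e beta w0 w].
Proof.
have b0 : 0 < beta by case/andP: beta01.
have u1 i t : `|relax beta (gamma i) t| <= 1.
  by have /andP[r0 r1] := relax_itv t beta01 (gamma_ge0 i); rewrite ger0_norm.
have /choice[w wE] : forall t, exists g : H,
    forall i, fourier g i = (relax beta (gamma i) t)%:C * fourier w0 i.
  by move=> t; apply: exists_multiplier => i; exact: u1.
exists w; split => //.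
- apply: (multiplier_continuous (u := fun i => relax beta (gamma i)) (w0 := w0)) => //.
  by move=> i; exact: continuous_relax.
- move=> i; have -> : (fun t => fourier (w t) i) = (fun t =>
    fourier w0 i * (relax beta (gamma i) t)%:C).
    by apply/funext => t; rewrite wE mulrC.
  exact: scalar_solution_relax.
- move=> t t0.
  have mE : (fun i => (ip w0 (e i) * mittag_leffler beta (- (gamma i * t `^ beta)%:C)) *: e i) =
     (fun i => ((relax beta (gamma i) t)%:C * fourier w0 i) *: e i).
    by apply/funext => i; rewrite -rmorphN mittag_leffler_real// mulrC.
  rewrite mE.
  have m1 i : `|(relax beta (gamma i) t)%:C| <= 1%:C by rewrite normc_realE lecR.
  have [g cg] := multiplier_cvg hilbert_norm e_basis w0 ler01 m1.
  suff <- : g = w t by [].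
  apply: (fourier_inj hilbert_norm e_basis) => i.
  by rewrite (fourier_limit hilbert_norm e_basis cg) wE.
Qed.

(** The coefficients of a continuous solution are continuous, and each solves a
    scalar problem, whose solution is unique. *)
Lemma heat_solution_unique (w0 : H) (v w : R -> H) :
  {within `[0, +oo[, continuous v} -> heat_solution ip gamma e beta w0 v ->
  {within `[0, +oo[, continuous w} -> heat_solution ip gamma e beta w0 w ->
  forall t, 0 <= t -> v t = w t.
Proof.
move=> cv hv cw hw t t0; apply: (fourier_inj hilbert_norm e_basis) => i.
have ReB (a b : R[i]) : complex.Re (a - b) = complex.Re a - complex.Re b.
  by case: a b => [a1 a2] [b1 b2].
have ImB (a b : R[i]) : complex.Im (a - b) = complex.Im a - complex.Im b.
  by case: a b => [a1 a2] [b1 b2].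
apply: (scalar_solution_unique beta01 (gamma_ge0 i) _ _ _ _ (hv i) (hw i) t0).
- exact: (@continuous_coordinate (@complex.Re R) v i ReB (@normc_ge_Re R) cv).
- exact: (@continuous_coordinate (@complex.Im R) v i ImB Im_norm_le cv).
- exact: (@continuous_coordinate (@complex.Re R) w i ReB (@normc_ge_Re R) cw).
- exact: (@continuous_coordinate (@complex.Im R) w i ImB Im_norm_le cw).
Qed.

(** The three assertions of the theorem share this construction; they differ by
    the bound [K] on the multiplier that maps the space of order [delta'] to the
    space of order [delta] at a fixed positive time. *)
Lemma heat_flow (delta delta' : R) (K : R -> R) (w0 : H) :
  sobolev ip gamma e delta' (fourier w0) ->
  (forall t i, 0 < t -> (1 + gamma i) `^ (delta / 2) * relax beta (gamma i) t <=
     K t * (1 + gamma i) `^ (delta' / 2)) ->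
  exists w : R -> H,
    [/\ unique_sobolev_solution ip gamma e beta delta w0 w,
        given_by_series ip gamma e beta w0 w &
        forall t i, fourier (w t) i = (relax beta (gamma i) t)%:C * fourier w0 i].
Proof.
move=> [g0 g0E] KP; have [w [wE cw hw sw]] := heat_solution_exists w0.
have g1 i : 0 < 1 + gamma i by rewrite ltr_pwDl.
exists w; split => //; split.
  split => // t t0.
  pose m i := (1 + gamma i) `^ (delta / 2) * relax beta (gamma i) t / (1 + gamma i) `^ (delta'
      / 2).
  have [|g gE] := @exists_multiplier g0 m (K t).
    move=> i; have /andP[r0 _] := relax_itv t beta01 (gamma_ge0 i).
    rewrite ger0_norm; last by rewrite divr_ge0 ?powR_ge0// mulr_ge0// powR_ge0.
    by rewrite ler_pdivrMr ?powR_gt0// KP.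
  exists g; apply/funext => i; rewrite gE g0E /potential wE /m.
  rewrite !mulrA -!rmorphM/=; congr (_%:C * _).
  by rewrite divfK// gt_eqF// powR_gt0.
by move=> v [cv hv _] t t0; exact: (heat_solution_unique cv hv cw hw).
Qed.

End heat_flow.

(** * The bottom of the spectrum *)

Section spectral_gap.
Context {R : realType} {H : completeNormedModType R[i]}.
Context (ip : {dot H for Num.conj}) {I : Type} (L : operator H) (gamma : I -> R) (e : I -> H).
Hypothesis gamma_ge0 : forall i, 0 <= gamma i.
Hypothesis e_unit : forall i, `|e i| = 1.
Hypothesis L_eigen : forall i, op_dom L (e i) /\ L (e i) = (gamma i)%:C *: e i.

(** If [0] is in the resolvent set, [L] has a continuous inverse [B], and
    [gamma i * B (e i) = e i]: a bound on [B] near [0] bounds [gamma i] from below. *)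
Lemma spectral_gap : ~ spectrum L 0 -> exists2 c : R, 0 < c & forall i, c <= gamma i.
Proof.
move=> /contrapT[B [cB _ BL]].
have Be i : (gamma i)%:C *: B (e i) = e i.
  have [dom Le] := L_eigen i.
  rewrite -linearZ/= -Le; have := BL _ dom.
  by rewrite scale0r subr0.
have B0 : B 0 = 0 by exact: linear0.
have : \forall x \near (0 : H), ball (B 0) 1 (B x).
  exact: (cB 0 (ball (B 0) 1) (nbhsx_ballx _ _ ltr01)).
move=> /nbhs_ballP[r /= r0 rB].
have [c0 rE] := gt0_realC r0.
exists (complex.Re r / 2) => [|i]; first by rewrite divr_gt0.
have h : `|B ((complex.Re r / 2)%:C *: e i)| < 1.
  have /rB : ball 0 r ((complex.Re r / 2)%:C *: e i).
    rewrite -ball_normE/= sub0r normrN normrZ e_unit mulr1 normc_realE rE ltcR.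
    by rewrite gtr0_norm ?divr_gt0//= ltr_pdivrMr// mulr_natr mulr2n ltrDl.
  by rewrite B0 -ball_normE/= sub0r normrN.
move: h; rewrite linearZ/= normrZ normc_realE gtr0_norm ?divr_gt0// => h.
have gB : (gamma i)%:C * `|B (e i)| = 1.
  by rewrite -(e_unit i) -{2}(Be i) normrZ normc_realE ger0_norm.
rewrite -lecR -[leLHS]mulr1 -gB mulrCA ler_piMr//; last exact: ltW.
by rewrite lecR.
Qed.

End spectral_gap.

(** * The theorem *)

Theorem theorem1p1 (R : realType) (H : completeNormedModType R[i])
    (ip : {dot H for Num.conj}) (I : countType) (L : operator H)
    (gamma : I -> R) (e : I -> H) (beta delta : R)
    (hilbert_norm : forall x : H, `|x| ^+ 2 = ip x x)
    (H_separable : separable H)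
    (L_dense : dense (op_dom L))
    (L_positive : forall i, 0 <= gamma i)
    (L_spectrum : spectrum L = range (fun i => (gamma i)%:C))
    (L_discrete : discrete_subset (spectrum L))
    (L_eigen : forall i, op_dom L (e i) /\ L (e i) = (gamma i)%:C *: e i)
    (L_basis : orthonormal_basis ip e)
    (beta_gt0 : 0 < beta) (beta_le1 : beta <= 1) :
  [/\ spectrum L 0 ->
        exists C : R, 0 < C /\
        forall w0 : H, sobolev ip gamma e delta (fourier ip e w0) ->
        exists w : R -> H,
          [/\ unique_sobolev_solution ip gamma e beta delta w0 w,
              given_by_series ip gamma e beta w0 w &
              forall t : R, 0 <= t ->
                (sobolev_norm gamma delta (fourier ip e (w t)) <=
                 C%:E * sobolev_norm gamma delta (fourier ip e w0))%E],
      ~ spectrum L 0 ->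
        exists C : R, 0 < C /\
        forall w0 : H, sobolev ip gamma e delta (fourier ip e w0) ->
        exists w : R -> H,
          [/\ unique_sobolev_solution ip gamma e beta delta w0 w,
              given_by_series ip gamma e beta w0 w &
              forall t : R, 0 <= t ->
                (sobolev_norm gamma delta (fourier ip e (w t)) <=
                 (C * (1 + t `^ beta)^-1)%:E *
                 sobolev_norm gamma delta (fourier ip e w0))%E]
    & exists C : R, 0 < C /\
        forall w0 : H, sobolev ip gamma e (delta - 2) (fourier ip e w0) ->
        exists w : R -> H,
          [/\ unique_sobolev_solution ip gamma e beta delta w0 w,
              given_by_series ip gamma e beta w0 w &
              forall t : R, 0 < t ->
                (sobolev_norm gamma delta (fourier ip e (w t)) <=
                 (C * (1 + t `^ (- beta)))%:E *
                 sobolev_norm gamma (delta - 2) (fourier ip e w0))%E] ].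
Proof.
have b01 : 0 < beta <= 1 by apply/andP.
have G0 : 0 <= Gamma (beta + 1) :> R by rewrite ltW// Gamma_gt0// addr_gt0.
have g1 i : 0 < 1 + gamma i by rewrite ltr_pwDl.
pose D : R := 1 + Gamma (beta + 1).
have D0 : 0 < D by rewrite ltr_pwDl.
have flow1 w0 : sobolev ip gamma e delta (fourier ip e w0) ->
    exists w : R -> H,
    [/\ unique_sobolev_solution ip gamma e beta delta w0 w,
        given_by_series ip gamma e beta w0 w &
        forall t i, fourier ip e (w t) i = (relax beta (gamma i) t)%:C * fourier ip e w0 i].
  move=> sw0; apply: (heat_flow (K := fun=> 1) _ _ _ _ sw0) => // t i _.
  have /andP[r0 r1] := relax_itv t b01 (L_positive i).
  by rewrite mul1r ler_piMr// powR_ge0.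
split.
- move=> _; exists 1; split => // w0 /flow1[w [uw sw wE]].
  exists w; split => // t t0.
  apply: (sobolev_norm_le L_positive ler01 (wE t)) => i.
  have /andP[r0 r1] := relax_itv t b01 (L_positive i).
  by rewrite ger0_norm ?mulr_ge0 ?powR_ge0// mul1r ler_piMr// powR_ge0.
- move=> spec0.
  have e_unit i : `|e i| = 1.
    have [oe _] := L_basis; apply/eqP.
    by rewrite -(@eqrXn2 _ 2)// hilbert_norm oe eqxx expr1n.
  have [c c0 gap] := spectral_gap L_positive e_unit L_eigen spec0.
  pose c1 := Num.min 1 c.
  have c10 : 0 < c1 by rewrite lt_min ltr01.
  exists (D / c1); split; first by rewrite divr_gt0.
  move=> w0 /flow1[w [uw sw wE]]; exists w; split => // t t0.
  have t10 : 0 < 1 + t `^ beta by rewrite ltr_pwDl// powR_ge0.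
  have K0 : 0 <= D / c1 * (1 + t `^ beta)^-1 by rewrite !mulr_ge0// ?invr_ge0// ltW.
  apply: (sobolev_norm_le L_positive K0 (wE t)) => i.
  have /andP[r0 r1] := relax_itv t b01 (L_positive i).
  rewrite ger0_norm ?mulr_ge0 ?powR_ge0// mulrC ler_wpM2r ?powR_ge0//.
  rewrite -mulrA -invfM ler_pdivlMr ?mulr_gt0//.
  apply: le_trans (relax_decay t b01 (L_positive i)).
  rewrite mulrC ler_wpM2r// mulrDr mulr1 lerD//; first by rewrite ge_min lexx.
  by rewrite ler_wpM2r ?powR_ge0// (le_trans _ (gap i))// ge_min lexx orbT.
- have part3 t i : 0 < t -> (1 + gamma i) `^ (delta / 2) * relax beta (gamma i) t <=
      (D * (1 + t `^ (- beta))) * (1 + gamma i) `^ ((delta - 2) / 2).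
    move=> t0; have /andP[r0 r1] := relax_itv t b01 (L_positive i).
    have -> : delta / 2 = 1 + (delta - 2) / 2 by field.
    rewrite powRD ?(gt_eqF (g1 i)) ?implybT// powRr1 ?(ltW (g1 i))//.
    rewrite mulrAC ler_wpM2r ?powR_ge0//.
    have tb : 0 < t `^ beta by exact: powR_gt0.
    have h : 1 + gamma i <= (1 + t `^ (- beta)) * (1 + gamma i * t `^ beta).
      have -> : (1 + t `^ (- beta)) * (1 + gamma i * t `^ beta) =
          1 + gamma i + (gamma i * t `^ beta + (t `^ beta)^-1).
        by rewrite powRN; field; rewrite gt_eqF.
      by rewrite lerDl addr_ge0 ?mulr_ge0 ?invr_ge0// ltW.
    apply: (@le_trans _ _ ((1 + t `^ (- beta)) * (1 + gamma i * t `^ beta) * relax beta (gamma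
        i) t)).
      by rewrite ler_wpM2r.
    rewrite -mulrA [leRHS]mulrC ler_wpM2l ?addr_ge0 ?powR_ge0//.
    exact: relax_decay.
  exists D; split => // w0 sw0.
  have [w [uw sw wE]] := @heat_flow _ _ ip I gamma e beta hilbert_norm L_basis L_positive b01
    delta (delta - 2) (fun t => D * (1 + t `^ (- beta))) w0 sw0 part3.
  exists w; split => // t t0.
  have K0 : 0 <= D * (1 + t `^ (- beta)) by rewrite mulr_ge0 ?addr_ge0 ?powR_ge0// ltW.
  apply: (sobolev_norm_le L_positive K0 (wE t)) => i.
  have /andP[r0 r1] := relax_itv t b01 (L_positive i).
  by rewrite ger0_norm ?mulr_ge0 ?powR_ge0// part3.
Qed.
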